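(* Let $G$ be a nontrivial finite group which is not nice, that is, $G$ is neither cyclic of prime-power order nor generalized quaternion. Then $T_G(n)=0$ for every integer $n\geq 1$, where $T_G$ denotes the topological Poljak--R\''{o}dl function of $G$.
   Context: A finite group is called nice if it is either cyclic of prime-power order or a generalized quaternion group (a generalized quaternion group here is the 2-group $Q_{2^k}$ of order $2^k$, $k\geq 3$, including $Q_8$). A finite free $G$-simplicial complex is a finite simplicial complex with a simplicial $G$-action that is free on its geometric realization; as a $G$-space it is identified with its geometric realization. For $k\geq 0$, let $E_kG=G^{*(k+1)}$ be the $(k+1)$-fold topological join of the discrete group $G$, equipped with the diagonal $G$-action (left multiplication on each copy of $G$). In particular $E_0G=G$. For a free $G$-space $X$, the topological index is $$\operatorname{ind}_G(X)=\min\{k\geq 0 : \text{there exists a continuous } G\text{-equivariant map } X\to E_kG\}.$$ For a nontrivial finite group $G$ and $n\geq 0$, the topological Poljak--R\''{o}dl function of $G$ is $$T_G(n)=\min\{\operatorname{ind}_G(X\times Y) : X \text{ and } Y \text{ are finite free } G\text{-simplicial complexes with } \operatorname{ind}_G(X)=\operatorname{ind}_G(Y)=n\},$$ where $X\times Y$ (product of geometric realizations) carries the diagonal $G$-action $g\cdot(x,y)=(gx,gy)$. *)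

(* Defs.v *)
From HB Require Import structures.
From mathcomp Require Import all_boot all_order all_algebra.
From mathcomp Require Import all_fingroup all_solvable.
From mathcomp Require Import generic_quotient.
From mathcomp Require Import all_classical all_reals.
From mathcomp Require Import topology normedtype.

Set Implicit Arguments.
Unset Strict Implicit.
Unset Printing Implicit Defensive.

Import Order.TTheory GRing.Theory Num.Theory.
Import numFieldNormedType.Exports.

Local Open Scope quotient_scope.
Local Open Scope classical_set_scope.
Local Open Scope ring_scope.

Definition generalized_quaternion (gT : finGroupType) : Prop :=
  exists2 k : nat, (3 <= k)%N & [set: gT]%G \isog [set: 'Q_((2 ^ k)%N)]%G.

Definition nice (gT : finGroupType) : Prop :=
  (cyclic [set: gT]%G /\ exists p k : nat, prime p /\ #|gT| = (p ^ k)%N)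
  \/ generalized_quaternion gT.

(* Continuity in the group variable is automatic, the group being discrete. *)
Record gSpace (gT : finGroupType) := GSpace {
  gspace_sort :> topologicalType;
  gact : gT -> gspace_sort -> gspace_sort;
  gact1 : forall x, gact 1%g x = x;
  gactM : forall g h x, gact (g * h)%g x = gact g (gact h x);
  gact_continuous : forall g, continuous (gact g) }.

Definition free_gSpace (gT : finGroupType) (X : gSpace gT) : Prop :=
  forall (g : gT) (x : X), gact g x = x -> g = 1%g.

Definition equivariant (gT : finGroupType) (X Y : gSpace gT) (f : X -> Y) :
    Prop :=
  forall g x, f (gact g x) = gact g (f x).

Section Product.
Variables (gT : finGroupType) (X Y : gSpace gT).

Definition prod_gact (g : gT) (p : X * Y) : X * Y :=
  (gact g p.1, gact g p.2).

Lemma prod_gact1 p : prod_gact 1%g p = p.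
Proof. by case: p => x y; rewrite /prod_gact !gact1. Qed.

Lemma prod_gactM g h p : prod_gact (g * h)%g p = prod_gact g (prod_gact h p).
Proof. by rewrite /prod_gact !gactM. Qed.

Lemma prod_gact_continuous g : continuous (prod_gact g).
Proof.
move=> p; apply: cvg_pair => /=.
- apply: (@continuous_comp (X * Y)%type X X fst (gact g)); first exact: cvg_fst.
  exact: gact_continuous.
- apply: (@continuous_comp (X * Y)%type Y Y snd (gact g)); first exact: cvg_snd.
  exact: gact_continuous.
Qed.

Definition prod_gSpace : gSpace gT :=
  GSpace prod_gact1 prod_gactM prod_gact_continuous.

End Product.

Section DiscreteGroup.
Variable gT : finGroupType.

Definition left_mul (g : gT) (x : discrete_topology gT) :
    discrete_topology gT :=
  (g * (x : gT))%g.

Lemma left_mul1 x : left_mul 1%g x = x.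
Proof. exact: mul1g. Qed.

Lemma left_mulM g h x : left_mul (g * h)%g x = left_mul g (left_mul h x).
Proof. by rewrite /left_mul mulgA. Qed.

Lemma left_mul_continuous g : continuous (left_mul g).
Proof. by apply/continuousP => A _; exact: discrete_open. Qed.

Definition group_gSpace : gSpace gT :=
  GSpace left_mul1 left_mulM left_mul_continuous.

End DiscreteGroup.

Lemma ptws_continuous (Z T : topologicalType) (I : Type)
    (f : Z -> {ptws I -> T}) :
  (forall i, continuous (fun z => f z i)) -> continuous f.
Proof.
move=> fc z; apply/cvg_sup => i U [_ [[W oW <-] /= Wfz]] WU.
apply: filterS WU _; apply: (fc i z W); exact: open_nbhs_nbhs.
Qed.

Lemma set_type_continuous (Z X : topologicalType) (A : set X)
    (f : Z -> set_type A) :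
  continuous (fun z => \val (f z)) -> continuous f.
Proof.
move=> fc z U [_ [[W oW <-] /= Wfz]] WU.
apply: filterS WU _; apply: (fc z W); exact: open_nbhs_nbhs.
Qed.

Definition std_simplex (R : realType) (I : finType) : set {ptws I -> R} :=
  [set t | (forall i, 0 <= t i) /\ \sum_i t i = 1].

(* The n.+1-fold join: the quotient of  Delta^n * X^(n+1)  by the relation    *)
(* which forgets the i-th point whenever the i-th barycentric coordinate is 0. *)
Section JoinSpace.
Variables (R : realType) (n : nat) (X : topologicalType).

Definition prejoin : topologicalType :=
  (set_type (@std_simplex R 'I_n.+1) * {ptws 'I_n.+1 -> X})%type.

Definition join_rel (p q : prejoin) : bool :=
  `[< p.1 = q.1 /\ forall i, \val p.1 i != 0 -> p.2 i = q.2 i >].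

Lemma join_rel_equiv : equiv_class_of join_rel.
Proof.
have sub p q : join_rel p q -> join_rel q p.
  by move=> /asboolP[e E]; apply/asboolP; split=> // i; rewrite -e => /E.
split=> [p|p q|q p r].
- exact/asboolP.
- by apply/idP/idP; exact: sub.
- move=> /asboolP[e E] /asboolP[e' E']; apply/asboolP; split.
    by rewrite e e'.
  by move=> i ei; rewrite E // E' // -e.
Qed.

Canonical join_equiv := EquivRelPack join_rel_equiv.

Definition join : topologicalType :=
  quotient_topology {eq_quot join_equiv}.

Definition join_pi (p : prejoin) : join := \pi_{eq_quot join_equiv} p.

Definition join_repr (x : join) : prejoin :=
  repr (x : {eq_quot join_equiv}).

Lemma join_reprK x : join_pi (join_repr x) = x.
Proof. exact: reprK. Qed.

Lemma join_piP p q : join_pi p = join_pi q <->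
  p.1 = q.1 /\ forall i, \val p.1 i != 0 -> p.2 i = q.2 i.
Proof.
have E := eqmodE join_equiv p q.
split=> [pq|pq].
  suff : (p == q %[mod {eq_quot join_equiv}]) by rewrite E => /asboolP.
  exact/eqP.
suff /eqP : (p == q %[mod {eq_quot join_equiv}]) by [].
by rewrite E; apply/asboolP.
Qed.

End JoinSpace.

Section JoinAction.
Variables (R : realType) (n : nat) (gT : finGroupType) (X : gSpace gT).

Definition prejoin_gact (g : gT) (p : prejoin R n X) : prejoin R n X :=
  (p.1, fun i => gact g (p.2 i)).

Definition join_gact (g : gT) (x : join R n X) : join R n X :=
  join_pi (prejoin_gact g (join_repr x)).

Lemma join_gactE g p : join_gact g (join_pi p) = join_pi (prejoin_gact g p).
Proof.
apply/join_piP; have /join_piP[e E] := join_reprK (join_pi p).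
by split=> //= i /E ->.
Qed.

Lemma join_gact1 x : join_gact 1%g x = x.
Proof.
rewrite -(join_reprK x) join_gactE; congr join_pi.
by case: (join_repr x) => t y; congr pair; apply/funext => i; rewrite /= gact1.
Qed.

Lemma join_gactM g h x : join_gact (g * h)%g x = join_gact g (join_gact h x).
Proof.
rewrite -(join_reprK x) !join_gactE; congr join_pi.
by congr pair; apply/funext => i; rewrite /= gactM.
Qed.

Lemma prejoin_gact_continuous g : continuous (prejoin_gact g).
Proof.
have H : continuous (fun p : prejoin R n X =>
    (fun i => gact g (p.2 i)) : {ptws 'I_n.+1 -> X}).
  apply: ptws_continuous => i p.
  apply: (@continuous_comp _ X X (fun p : prejoin R n X => p.2 i) (gact g));
    last exact: gact_continuous.
  apply: (@continuous_comp _ {ptws 'I_n.+1 -> X} X snd (fun y => y i)).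
    exact: cvg_snd.
  exact: (@proj_continuous 'I_n.+1 (fun=> X) i).
move=> p.
apply: (@cvg_pair _ _ _ (nbhs p) (nbhs p.1)
  (nbhs ((fun i => gact g (p.2 i)) : {ptws 'I_n.+1 -> X}))
  _ _ _ fst (fun q => fun i => gact g (q.2 i))) => /=.
  exact: cvg_fst.
exact: H.
Qed.

Lemma join_gact_continuous g : continuous (join_gact g).
Proof.
apply/(@quotient_continuous _ {eq_quot (join_equiv R n X)}) => p.
rewrite (_ : join_gact g \o _ = @join_pi R n X \o prejoin_gact g); last first.
  by apply/funext => q; rewrite /= -join_gactE.
apply: continuous_comp; first exact: prejoin_gact_continuous.
exact: pi_continuous.
Qed.

Definition join_gSpace : gSpace gT :=
  GSpace join_gact1 join_gactM join_gact_continuous.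

End JoinAction.

Definition EG (R : realType) (gT : finGroupType) (k : nat) : gSpace gT :=
  join_gSpace R k (group_gSpace gT).

Record gComplex (gT : finGroupType) := GComplex {
  vertex : finType;
  simplices : {set {set vertex}};
  simplices_neq0 : forall s, s \in simplices -> s != finset.set0;
  simplices_vertex : forall v, [set v]%SET \in simplices;
  simplices_sub : forall s t : {set vertex},
    s \in simplices -> t \subset s -> t != finset.set0 -> t \in simplices;
  vact : gT -> vertex -> vertex;
  vact1 : forall v, vact 1%g v = v;
  vactM : forall g h v, vact (g * h)%g v = vact g (vact h v);
  vact_simplicial : forall g s,
    s \in simplices -> (vact g @: s)%SET \in simplices }.

Section Realization.
Variables (R : realType) (gT : finGroupType) (K : gComplex gT).

Definition realization_set : set {ptws vertex K -> R} :=
  [set x | std_simplex x /\ [set v | x v != 0]%SET \in simplices K].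

Definition realization : topologicalType := set_type realization_set.

Lemma vactK g : cancel (@vact _ K g) (@vact _ K g^-1%g).
Proof. by move=> v; rewrite -vactM mulVg vact1. Qed.

Lemma vactVK g : cancel (@vact _ K g^-1%g) (@vact _ K g).
Proof. by move=> v; rewrite -vactM mulgV vact1. Qed.

(* The affine extension of the vertex action: it maps the point               *)
(* sum_v x_v v  to  sum_v x_v (g v).                                          *)
Definition coord_gact (g : gT) (x : {ptws vertex K -> R}) :
    {ptws vertex K -> R} :=
  fun v => x (vact g^-1%g v).

Lemma coord_gact_realization g x :
  realization_set x -> realization_set (coord_gact g x).
Proof.
move=> [[x0 x1] xK]; split; first split.
- by move=> v; exact: x0.
- rewrite -x1 (reindex_inj (can_inj (@vactK g))) /=.
  by apply: eq_bigr => v _; rewrite /coord_gact vactK.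
- rewrite (_ : finset _ = (vact g @: [set v | x v != 0])%SET).
    exact: vact_simplicial.
  apply/finset.setP => v; rewrite inE; apply/idP/imsetP => [xv|[w + ->]].
    by exists (vact g^-1%g v); rewrite ?inE ?vactVK.
  by rewrite inE /coord_gact vactK.
Qed.

Definition realization_gact (g : gT) (x : realization) : realization :=
  exist _ (coord_gact g (\val x))
    (mem_set (coord_gact_realization g (set_mem (valP x)))).

Lemma realization_gact1 x : realization_gact 1%g x = x.
Proof.
by apply/val_inj/funext => v; rewrite /= /coord_gact invg1 vact1.
Qed.

Lemma realization_gactM g h x :
  realization_gact (g * h)%g x = realization_gact g (realization_gact h x).
Proof.
by apply/val_inj/funext => v; rewrite /= /coord_gact invMg vactM.
Qed.

Lemma realization_gact_continuous g : continuous (realization_gact g).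
Proof.
apply: set_type_continuous; apply: ptws_continuous => v x /=.
apply: (@continuous_comp realization {ptws vertex K -> R} R
  set_val (fun y => y (vact g^-1%g v))).
  exact: initial_continuous.
exact: (@proj_continuous (vertex K) (fun=> R) (vact g^-1%g v)).
Qed.

Definition realization_gSpace : gSpace gT :=
  GSpace realization_gact1 realization_gactM realization_gact_continuous.

End Realization.

Definition free_gComplex (R : realType) (gT : finGroupType)
    (K : gComplex gT) : Prop :=
  free_gSpace (realization_gSpace R K).

(* Minimum of a set of natural numbers; None when the set is empty. *)
Definition min_nat (S : set nat) : option nat :=
  xget None [set o | exists m, o = Some m /\ S m /\
                               forall k, S k -> (m <= k)%N].

Lemma min_natP (S : set nat) (m : nat) :
  min_nat S = Some m <-> S m /\ forall k, S k -> (m <= k)%N.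
Proof.
rewrite /min_nat; split=> [|[Sm mS]].
  by case: xgetP => [_ -> [k [-> Sk]] [<-] //|].
case: xgetP => [_ _ [k [-> [Sk kS]]]|/(_ (Some m)) []]; last by exists m.
by congr Some; apply/eqP; rewrite eqn_leq kS // mS.
Qed.

Definition ind (R : realType) (gT : finGroupType) (X : gSpace gT) :
    option nat :=
  min_nat [set k | exists f : X -> EG R gT k, continuous f /\ equivariant f].

Definition poljak_rodl (R : realType) (gT : finGroupType) (n : nat) :
    option nat :=
  min_nat [set k | exists K L : gComplex gT,
    [/\ free_gComplex R K, free_gComplex R L,
        ind R (realization_gSpace R K) = Some n,
        ind R (realization_gSpace R L) = Some n &
        ind R (prod_gSpace (realization_gSpace R K)
                           (realization_gSpace R L)) = Some k]].

(* Main.v *)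
Require Import Defs.
From mathcomp Require Import all_boot all_order all_algebra.
From mathcomp Require Import all_fingroup all_solvable.
From mathcomp Require Import all_classical all_reals.
From mathcomp Require Import topology normedtype sequences.
From mathcomp Require Import lra.

(** A group that is not nice has two subgroups [H] and [K] of prime order such
    that [H] meets every conjugate of [K] trivially
    ([not_nice_disjoint_cycles]).  If two primes divide the order of the group,
    subgroups of these two orders will do.  In a p-group, take for [H] a central
    subgroup of order p and for [K] any other one, which exists because a
    p-group with only one subgroup of order p is cyclic or generalized
    quaternion.

    The two witnesses are the complexes [G x_H E_n H] and [G x_K E_n K], realized
    as subcomplexes of [E_n G] ([coset_join]).  The first one maps equivariantly
    to the discrete set [G/H] and the second one to [G/K].  By the choice of [H]
    and [K] the group acts freely on [G/H x G/K], so the latter maps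
    equivariantly to [G], and the product of the two complexes has index 0
    ([product_map]).

    It remains to see that both complexes have index [n] ([ind_coset_join]).
    Being subcomplexes of [E_n G], they map to [E_n G] ([to_join]).  The lower
    bound ([lower_bound]) is a theorem of Dold, of Borsuk-Ulam type: there is no
    [H]-equivariant map from [E_n H] to [E_k G] if [k < n] and [H] has prime
    order p.  It is proved as follows, without homology groups.

    A map [f] to [E_k G] pulls back, for each [i] and [g], the open set where the
    [i]-th join coordinate is positive and the [i]-th point is [g].  For fixed
    [i] these sets are disjoint and permuted by the group.  By compactness, the
    points of a sufficiently small simplex all lie in one of these sets
    ([lebesgue_number]).  Label such a simplex by the pair [(i, g)] with the least
    possible [i].  Along a flag of faces of a small simplex the index [i] is
    monotone, and equal indices force equal labels, so that a flag of more than
    [k + 1] faces repeats a label ([flag_apex_repeats]).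

    This is played against a computation in the cohomology of the cyclic group of
    order p.  On the side of the labels there are cochains [psi_j] with values in
    the field of p elements, which vanish on repeated labels and whose
    coboundaries are alternately the orbit difference and the orbit sum of
    [psi_(j+1)] ([cyclic_cochainP]).  On the side of [E_n H] there are chains
    [e_j], built by coning, whose boundaries are given by the same operators
    ([join_chain_coboundary]).  Pull [psi_j] back to [E_n H] along iterated
    barycentric subdivision and the labelling.  Since p = 0 in the coefficients,
    the value of the pulled back [psi_j], summed over an orbit, on [e_j] does not
    depend on [j] ([join_chain_orbit_sum]).  It is 1 for [j = 0], and it is 0 for
    [j = n > k] because of the repeated labels. *)

Set Implicit Arguments.
Unset Strict Implicit.
Unset Printing Implicit Defensive.

Import Order.TTheory GRing.Theory Num.Theory.
Import numFieldNormedType.Exports.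

Local Open Scope classical_set_scope.
Local Open Scope ring_scope.

(* Not the function underlying a group action in the sense of finite groups. *)
Local Notation gact := Defs.gact.

(** * Cochains on finite sequences *)

(** The simplicial coboundary in the augmented complex of ordered simplices, the
    empty sequence being the simplex of dimension -1.  The recursion is the
    formula for the boundary of a cone, [d(x * s) = s - x * d s], read on
    cochains; it spares all index computations below. *)
Fixpoint coboundary (T : Type) (M : zmodType) (phi : seq T -> M) (s : seq T) : M :=
  if s is x :: s' then phi s' - coboundary (phi \o cons x) s' else 0.

Fixpoint faces (T : Type) (s : seq T) : seq (seq T) :=
  if s is x :: s' then s' :: map (cons x) (faces s') else [::].

Section Coboundary.
Variables (M : zmodType).
Implicit Types T : eqType.

Lemma eq_in_coboundary T (phi psi : seq T -> M) s :
  {in faces s, phi =1 psi} -> coboundary phi s = coboundary psi s.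
Proof.
elim: s phi psi => //= x s IH phi psi E; congr (_ - _).
  by apply: E; rewrite mem_head.
by apply: IH => u us; apply: E; rewrite inE map_f ?orbT.
Qed.

Lemma coboundaryB T (phi psi : seq T -> M) s :
  coboundary (fun u => phi u - psi u) s = coboundary phi s - coboundary psi s.
Proof.
elim: s phi psi => [|x s IH] phi psi /=; first by rewrite subr0.
rewrite (IH (phi \o cons x) (psi \o cons x)).
by rewrite !opprD !opprK addrACA.
Qed.

Lemma coboundary0 T s : coboundary (fun _ : seq T => 0 : M) s = 0.
Proof. by elim: s => //= x s IH; rewrite (IH : coboundary _ _ = _) subr0. Qed.

Lemma coboundary_sum T n (phi : 'I_n -> seq T -> M) s :
  coboundary (fun u => \sum_i phi i u) s = \sum_i coboundary (phi i) s.
Proof.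
elim: s phi => [|x s IH] phi /=; first by rewrite big1.
by rewrite (IH (fun i => phi i \o cons x)) -sumrB.
Qed.

Lemma coboundary_map (T U : eqType) (g : T -> U) (phi : seq U -> M) s :
  coboundary (phi \o map g) s = coboundary phi (map g s).
Proof.
elim: s phi => [|x s IH] phi //=; congr (_ - _).
by rewrite -(IH (phi \o cons (g x))); apply: eq_in_coboundary.
Qed.

Lemma coboundaryK T (phi : seq T -> M) s : coboundary (coboundary phi) s = 0.
Proof.
elim: s phi => [|x s IH] phi //=.
have -> : coboundary (coboundary phi \o cons x) s =
    coboundary (fun u => phi u - coboundary (phi \o cons x) u) s.
  exact: eq_in_coboundary.
by rewrite coboundaryB IH subr0 subrr.
Qed.

Lemma size_faces T (s u : seq T) : u \in faces s -> size u = (size s).-1.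
Proof.
elim: s u => //= x s IH u; rewrite inE => /predU1P[->//|/mapP[w ws ->]] /=.
by rewrite (IH _ ws); case: s ws {IH}.
Qed.

Lemma faces_subset T (s u : seq T) : u \in faces s -> {subset u <= s}.
Proof.
elim: s u => //= x s IH u; rewrite inE => /predU1P[->|/mapP[w ws ->]] y /=.
  by rewrite inE orbC => ->.
by rewrite !inE => /orP[->//|/(IH _ ws) ->]; rewrite orbT.
Qed.

Fixpoint repeats T (s : seq T) : bool :=
  if s is x :: s' then (ohead s' == Some x) || repeats s' else false.

(** The two faces that omit one of the two equal vertices cancel, and all other
    faces are still degenerate. *)
Lemma coboundary_repeats T (phi : seq T -> M) :
  (forall s, repeats s -> phi s = 0) -> forall s, repeats s -> coboundary phi s = 0.
Proof.
move=> phi0 s; elim: s phi phi0 => //= x s IH phi phi0.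
case: s IH => //= y s IH /orP[/eqP[->]|rs].
  rewrite opprB addrA addrAC subrr add0r.
  have : coboundary (phi \o cons x \o cons x) s = coboundary (fun _ => 0) s.
    by apply: eq_in_coboundary => u _ /=; apply: phi0; rewrite /= eqxx.
  by rewrite coboundary0.
rewrite phi0 // sub0r; apply/eqP; rewrite oppr_eq0; apply/eqP.
apply: (IH (phi \o cons x)) => // u ru /=; apply: phi0.
by rewrite /= ru orbT.
Qed.

Fixpoint subdiv_rec (T U : Type) (b : seq T -> U) (k : nat)
    (phi : seq U -> M) (s : seq T) : M :=
  if k is k'.+1 then coboundary (subdiv_rec b k' (phi \o cons (b s))) s
  else phi [::].

(** The cochain [phi] evaluated on the generalized barycentric subdivision of [s],
    in which each face [u] of [s] contributes the new vertex [b u].  Subdividing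
    [s] means coning from [b s] over the subdivision of the boundary of [s]
    ([subdivE]).  With [b] the barycentre this is the usual subdivision; with [b] a
    labelling of faces it pulls back cochains along that labelling. *)
Definition subdiv (T U : Type) (b : seq T -> U) (phi : seq U -> M) (s : seq T) : M :=
  subdiv_rec b (size s) phi s.

(** The simplices that occur in the subdivision of [s] are indexed by the complete
    flags of faces of [s]. *)
Inductive flag (T U : eqType) (b : seq T -> U) : seq T -> seq U -> Prop :=
| flag_nil : flag b [::] [::]
| flag_cons s u t : u \in faces s -> flag b u t -> flag b s (b s :: t).

Lemma size_flag (T U : eqType) (b : seq T -> U) s t : flag b s t -> size t = size s.
Proof.
elim=> // {t}s' u t us _ /= ->; rewrite (size_faces us).
by case: s' us.
Qed.

Lemma eq_in_subdiv (T U : eqType) (b : seq T -> U) (phi psi : seq U -> M) s :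
  (forall t, flag b s t -> phi t = psi t) -> subdiv b phi s = subdiv b psi s.
Proof.
rewrite /subdiv; move: {2 3 4}(size s) (erefl (size s)) => k.
elim: k s phi psi => [|k IH] s phi psi sk E /=.
  by apply: E; rewrite (size0nil sk); constructor.
apply: eq_in_coboundary => u us; apply: IH; first by rewrite (size_faces us) sk.
by move=> t ut /=; apply: E; apply: flag_cons ut.
Qed.

Lemma subdivE (T U : eqType) (b : seq T -> U) (phi : seq U -> M) s : s != [::] ->
  subdiv b phi s = coboundary (subdiv b (phi \o cons (b s))) s.
Proof.
case: s => // x s _.
apply: (@eq_in_coboundary T (subdiv_rec b (size s) (phi \o cons (b (x :: s))))).
by move=> u us; rewrite /subdiv (size_faces us).
Qed.

Lemma subdivB (T U : eqType) (b : seq T -> U) (phi psi : seq U -> M) s :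
  subdiv b (fun t => phi t - psi t) s = subdiv b phi s - subdiv b psi s.
Proof.
rewrite /subdiv; move: (size s) => k.
elim: k s phi psi => [|k IH] s phi psi //=.
rewrite -coboundaryB; apply: eq_in_coboundary => u us.
by rewrite (IH u (phi \o cons (b s)) (psi \o cons (b s))).
Qed.

Lemma subdiv_sum (T U : eqType) (b : seq T -> U) n (phi : 'I_n -> seq U -> M) s :
  subdiv b (fun t => \sum_i phi i t) s = \sum_i subdiv b (phi i) s.
Proof.
rewrite /subdiv; move: (size s) => k.
elim: k s phi => [|k IH] s phi //=.
rewrite -coboundary_sum; apply: eq_in_coboundary => u us.
by rewrite (IH u (fun i => phi i \o cons (b s))).
Qed.

(** Subdivision is a chain map: by induction the boundary of the cone from [b s]
    over the subdivided boundary of [s] is that subdivided boundary minus a cone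
    over the subdivision of [d d s = 0]. *)
Lemma subdiv_coboundary (T U : eqType) (b : seq T -> U) (phi : seq U -> M) s :
  subdiv b (coboundary phi) s = coboundary (subdiv b phi) s.
Proof.
move: {2}(size s) (erefl (size s)) => k.
elim: k s phi => [|k IH] s phi sk; first by rewrite (size0nil sk).
rewrite subdivE -?size_eq0 ?sk //.
transitivity (coboundary (fun u => subdiv b phi u -
    coboundary (subdiv b (phi \o cons (b s))) u) s); last first.
  by rewrite coboundaryB coboundaryK subr0.
apply: eq_in_coboundary => u us.
by rewrite -IH ?(size_faces us) ?sk // -subdivB.
Qed.

Lemma subdiv_map (T U : eqType) (b : seq T -> U) (g : T -> T) (h : U -> U)
    (phi : seq U -> M) (s : seq T) :
  (forall u : seq T, {subset u <= s} -> u != [::] -> b (map g u) = h (b u)) ->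
  subdiv b phi (map g s) = subdiv b (phi \o map h) s.
Proof.
move: {2}(size s) (erefl (size s)) => k.
elim: k s phi => [|k IH] s phi sk E; first by rewrite (size0nil sk).
have s0 : s != [::] by rewrite -size_eq0 sk.
rewrite subdivE; last by case: (s) s0.
rewrite subdivE // -coboundary_map; apply: eq_in_coboundary => u us /=.
rewrite IH ?(size_faces us) ?sk //; last first.
  by move=> w wu; apply: E => x /wu; apply: faces_subset us _.
by apply: eq_in_subdiv => t _ /=; rewrite E.
Qed.

End Coboundary.

(** * Chains of an iterated join of a cyclic group *)

Section CyclicOperators.
Variables (M : zmodType) (p : nat) (T : eqType) (h : T -> T).
Implicit Type phi : seq T -> M.

Definition orbit_sum phi (s : seq T) : M := \sum_(a < p) phi (map (iter a h) s).

Definition orbit_diff phi (s : seq T) : M := phi s - phi (map h s).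

(** In the standard resolution of the cyclic group, the boundary out of degree [j]
    is the orbit difference for odd [j] and the orbit sum for even [j]. *)
Definition orbit_op (j : nat) := if odd j then orbit_diff else orbit_sum.

Hypothesis h_order : forall x, iter p h x = x.

Lemma coboundary_orbit_op j phi s :
  coboundary (orbit_op j phi) s = orbit_op j (coboundary phi) s.
Proof.
rewrite /orbit_op; case: (odd j).
  rewrite /orbit_diff coboundaryB; congr (_ - _); exact: (@coboundary_map _ T T).
rewrite /orbit_sum (coboundary_sum (fun (a : 'I_p) u => phi (map (iter a h) u))).
by apply: eq_bigr => a _; exact: (@coboundary_map _ T T).
Qed.

Lemma orbit_sum_map phi s : orbit_sum phi (map h s) = orbit_sum phi s.
Proof.
rewrite /orbit_sum; case: p h_order => [|q] hq; first by rewrite !big_ord0.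
rewrite big_ord_recr [RHS]big_ord_recl /= addrC; congr (_ + _).
  rewrite -map_comp (eq_map (g := id)); first by rewrite (map_id s).
  by move=> x /=; rewrite -iterSr; exact: hq.
apply: eq_bigr => a _; rewrite -map_comp; congr phi; apply: eq_map => x /=.
by rewrite -iterSr.
Qed.

Lemma orbit_op_opS j phi s : orbit_op j (orbit_op j.+1 phi) s = 0.
Proof.
rewrite /orbit_op /=; case: odd => /=.
  by rewrite /orbit_diff orbit_sum_map subrr.
rewrite /orbit_sum /orbit_diff sumrB.
have := orbit_sum_map phi s; rewrite /orbit_sum => <-.
apply/eqP; rewrite subr_eq0; apply/eqP; apply: eq_bigr => a _.
rewrite -!map_comp; congr phi; apply: eq_map => x /=; by rewrite -iterS iterSr.
Qed.

End CyclicOperators.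

Section CyclicChains.
Variables (M : zmodType) (p : nat) (T : eqType) (h : T -> T).
Hypothesis h_order : forall x, iter p h x = x.
Variable v : nat -> T.
Implicit Type phi : seq T -> M.

Local Notation op := (orbit_op p h).

(** Evaluation of cochains on the chain [e_j] of the [j]-fold iterated join, where
    [e_0] is the vertex [v 0] and [e_(j+1)] is the cone with apex [v (j+1)] over
    the orbit difference or orbit sum of [e_j]. *)
Fixpoint join_chain (j : nat) phi : M :=
  if j is i.+1 then join_chain i (op i.+1 (phi \o cons (v i.+1)))
  else phi [:: v 0%N].

(** A set of simplices, stable under the group, that carries the chain [e_j]. *)
Inductive join_simplex : nat -> seq T -> Prop :=
| join_simplex0 : join_simplex 0 [:: v 0%N]
| join_simplex_act j s : join_simplex j s -> join_simplex j (map h s)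
| join_simplexS j s : join_simplex j s -> join_simplex j.+1 (v j.+1 :: s).

Lemma join_simplex_iter j s a : join_simplex j s -> join_simplex j (map (iter a h) s).
Proof.
move=> js; elim: a => [|a IH]; first by rewrite (map_id s).
rewrite (eq_map (g := h \o iter a h)) // map_comp; exact: join_simplex_act.
Qed.

Lemma eq_in_join_chain j phi psi :
  (forall s, join_simplex j s -> phi s = psi s) ->
  join_chain j phi = join_chain j psi.
Proof.
elim: j phi psi => [|j IH] phi psi E /=; first by apply: E; constructor.
apply: IH => s js; rewrite /orbit_op; case: odd.
  by rewrite /orbit_diff /= !E //; do ?constructor.
by apply: eq_bigr => a _ /=; apply: E; constructor; exact: join_simplex_iter.
Qed.

Lemma join_chainB j phi psi :
  join_chain j (fun s => phi s - psi s) = join_chain j phi - join_chain j psi.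
Proof.
elim: j phi psi => [|j IH] phi psi //=; rewrite -IH.
apply: eq_in_join_chain => s _; rewrite /orbit_op; case: odd => /=.
  by rewrite /orbit_diff /= !opprD !opprK addrACA.
by rewrite /orbit_sum -sumrB.
Qed.

Lemma join_chain_sum j n (phi : 'I_n -> seq T -> M) :
  join_chain j (fun s => \sum_i phi i s) = \sum_i join_chain j (phi i).
Proof.
elim: j phi => [|j IH] phi //=; rewrite -IH.
apply: eq_in_join_chain => s _; rewrite /orbit_op; case: odd => /=.
  by rewrite /orbit_diff /= sumrB.
by rewrite /orbit_sum exchange_big.
Qed.

Lemma join_chain0 j : join_chain j (fun=> 0) = 0.
Proof.
by have := join_chain_sum j (fun (_ : 'I_0) _ => 0); rewrite !big_ord0.
Qed.

(** The boundary of [e_(j+1)] is [orbit_op (j+1) e_j]: the remaining term is a cone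
    over the boundary of [orbit_op (j+1) e_j], which vanishes because two consecutive
    orbit operators compose to zero. *)
Lemma join_chain_coboundary :
  (forall phi, join_chain 0 (coboundary phi) = phi [::]) /\
  (forall j phi, join_chain j.+1 (coboundary phi) = join_chain j (op j.+1 phi)).
Proof.
split=> [phi|]; first by rewrite /= subr0.
have key j phi :
    join_chain j (coboundary (op j.+1 (phi \o cons (v j.+1)))) = 0 ->
    join_chain j.+1 (coboundary phi) = join_chain j (op j.+1 phi).
  move=> phi0; rewrite -[RHS]subr0 -phi0 -join_chainB /=.
  apply: eq_in_join_chain => s _; rewrite coboundary_orbit_op.
  rewrite /orbit_op; case: odd => /=.
    by rewrite /orbit_diff /= !opprD !opprK addrACA.
  by rewrite /orbit_sum -sumrB.
elim=> [|j IH] phi; apply: key; first by rewrite /= /orbit_op /= /orbit_diff /= subrr subr0.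
rewrite IH -[RHS](join_chain0 j); apply: eq_in_join_chain => s _.
exact: orbit_op_opS.
Qed.

Hypothesis charM : forall x : M, x *+ p = 0.

(** The invariant behind the Borsuk-Ulam theorem.  When the step is an orbit sum,
    the value in degree [j+1] equals the one in degree [j] by adjunction of
    boundary and coboundary.  When the step is an orbit difference, the adjunction
    only shows that the values [A (j+1) a - A j a] of the individual translates do
    not depend on [a]; their sum is then a multiple of [p], that is, zero. *)
Lemma join_chain_orbit_sum n (c : M) (Phi : nat -> seq T -> M) :
    orbit_sum p h (Phi 0%N) [:: v 0%N] = c ->
    (forall j s, (j < n)%N -> join_simplex j.+1 s ->
       coboundary (Phi j) s = op j.+1 (Phi j.+1) s) ->
  forall j, (j <= n)%N -> join_chain j (orbit_sum p h (Phi j)) = c.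
Proof.
move=> Phi0 PhiS; elim=> [|j IH] jn; first exact: Phi0.
rewrite -(IH (ltnW jn)); have [_ dE] := join_chain_coboundary.
have [jodd|jeven] := boolP (odd j).
  transitivity (join_chain j.+1 (coboundary (Phi j))).
    by apply: eq_in_join_chain => s js; rewrite PhiS // /orbit_op /= jodd.
  by rewrite dE /orbit_op /= jodd.
pose A i a := join_chain i (Phi i \o map (iter a h)).
have sumA i : join_chain i (orbit_sum p h (Phi i)) = \sum_(a < p) A i a.
  by rewrite /orbit_sum (join_chain_sum i (fun (a : 'I_p) s => Phi i (map (iter a h) s))).
have AS a : A j.+1 a - A j.+1 a.+1 = A j a - A j a.+1.
  have mapS (s : seq T) : map (iter a.+1 h) s = map (iter a h) (map h s).
    by rewrite -map_comp; apply: eq_map => x; rewrite /= -iterS iterSr.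
  rewrite /A -!join_chainB.
  transitivity (join_chain j.+1 (coboundary (Phi j \o map (iter a h)))).
    apply: eq_in_join_chain => s js.
    rewrite coboundary_map PhiS //; last exact: join_simplex_iter.
    rewrite /orbit_op /= jeven /orbit_diff /= -!map_comp.
    by congr (_ - Phi _ _); apply: eq_map.
  rewrite dE /orbit_op /= jeven; apply: eq_in_join_chain => s _.
  by rewrite /orbit_diff /= mapS.
rewrite !sumA; apply/eqP; rewrite -subr_eq0 -sumrB.
have B a : A j.+1 a - A j a = A j.+1 0%N - A j 0%N.
  elim: a => // a <-.
  have -> : A j.+1 a = A j a - A j a.+1 + A j.+1 a.+1 by rewrite -AS subrK.
  by rewrite -!addrA [RHS]addrC -!addrA addNr addr0 addrC.
under eq_bigr => a _ do rewrite B.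
by rewrite sumr_const card_ord charM.
Qed.

End CyclicChains.

(** * A compatible family of cyclic cochains *)

Section CyclicCochains.
Variables (M : zmodType) (p : nat).
Hypothesis p_pr : prime p.
Implicit Types (D : seq 'F_p -> M) (s : seq 'F_p).

Lemma ltn_Fp (x : 'F_p) : (x < p)%N.
Proof. by rewrite -[X in (_ < X)%N](Fp_cast p_pr). Qed.

Lemma natr_Fp (x : 'F_p) : (x : nat)%:R = x.
Proof. by apply: val_inj; rewrite /= val_Fp_nat // modn_small // ltn_Fp. Qed.

Definition succ_Fp (x : 'F_p) : 'F_p := x + 1.

Local Notation op := (orbit_op p succ_Fp).

Lemma iter_succ_Fp a (x : 'F_p) : iter a succ_Fp x = x + a%:R.
Proof.
by elim: a => [|a IH]; rewrite ?addr0 //= IH /succ_Fp -addrA natr1.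
Qed.

Definition head0 s : 'F_p := head 0 s.

(** Solves [orbit_sum psi = D] for an invariant [D], using as fundamental domain the
    sequences that start with [0]. *)
Definition sum_lift D s : M := if head0 s == 0 then D s else 0.

(** Solves [orbit_diff psi = D] for a [D] with vanishing orbit sum: in each orbit
    [psi] is [0] at the sequence that starts with [0], and the other values are
    the resulting partial sums. *)
Definition diff_lift D s : M :=
  - \sum_(a < head0 s) D [seq x - head0 s + a%:R | x <- s].

Lemma orbit_sum_lift D s : D [::] = 0 ->
  (forall s, orbit_diff succ_Fp D s = 0) -> orbit_sum p succ_Fp (sum_lift D) s = D s.
Proof.
move=> D0 Dinv; case: s => [|x s].
  by rewrite /orbit_sum big1 // => a _; rewrite /sum_lift /= D0 if_same.
have Diter a : D (map (iter a succ_Fp) (x :: s)) = D (x :: s).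
  elim: a => [|a IH]; first by rewrite (map_id (x :: s)).
  rewrite -{}IH; apply/eqP; rewrite eq_sym -subr_eq0 -(Dinv (map (iter a succ_Fp) (x :: s))).
  by rewrite /orbit_diff -map_comp.
rewrite /orbit_sum.
have [y xy] : exists y, x + y = 0 by exists (- x); rewrite subrr.
rewrite (bigD1 (Ordinal (ltn_Fp y))) //= big1 ?addr0 => [|a].
  by rewrite /sum_lift -(Diter y) /head0 /= iter_succ_Fp natr_Fp xy eqxx.
rewrite -val_eqE /= => ay; rewrite /sum_lift /head0 /= iter_succ_Fp.
case: eqP => // xa; case/negP: ay.
have <- : a%:R = y by apply: (addrI x); rewrite xa xy.
by rewrite val_Fp_nat // modn_small.
Qed.

Lemma orbit_diff_lift D s : D [::] = 0 ->
  (forall s, orbit_sum p succ_Fp D s = 0) -> orbit_diff succ_Fp (diff_lift D) s = D s.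
Proof.
move=> D0 Dsum; case: s => [|x s]; first by rewrite /orbit_diff subrr D0.
pose D' a := D [seq y - x + a%:R | y <- x :: s].
have E1 : diff_lift D (x :: s) = - \sum_(a < x) D' a by [].
have E2 : diff_lift D (map succ_Fp (x :: s)) = - \sum_(a < (x + 1)%R) D' a.
  rewrite /diff_lift /=; congr (- _); apply: eq_bigr => a _; rewrite /D'.
  rewrite -map_comp /head0 /= /succ_Fp !subrr; congr (D (_ :: _)).
  by apply: eq_map => y /=; rewrite opprD addrACA subrr addr0.
have Dx : D' x = D (x :: s).
  rewrite /D' natr_Fp (eq_map (g := id)) ?map_id // => y.
  by rewrite subrK.
have xS : nat_of_ord (x + 1 : 'F_p) = (x.+1 %% p)%N.
  by rewrite -(val_Fp_nat p_pr) -natr1 natr_Fp.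
rewrite /orbit_diff E1 E2 -Dx opprK addrC {}xS.
have := ltn_Fp x; rewrite leq_eqVlt => /orP[/eqP xp|xp].
  have Dp : \sum_(a < p) D' a = 0.
    rewrite -[RHS](Dsum [seq y - x | y <- x :: s]); apply: eq_bigr => a _.
    rewrite /D' -map_comp; congr D.
    by apply: eq_map => y; rewrite /= iter_succ_Fp.
  have /eqP : \sum_(a < x.+1) D' a = 0 by rewrite xp.
  rewrite big_ord_recr /= addr_eq0 => /eqP ->.
  by rewrite xp modnn big_ord0 opprK add0r.
by rewrite modn_small // big_ord_recr /= addrC addKr.
Qed.

Definition op_lift (j : nat) := if odd j then diff_lift else sum_lift.

Lemma repeats_map (T U : eqType) (f : T -> U) (s : seq T) : repeats s -> repeats (map f s).
Proof.
elim: s => //= x s IH /orP[|/IH ->]; last by rewrite orbT.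
by case: s {IH} => //= y s /eqP[->]; rewrite eqxx.
Qed.

Lemma op_lift_repeats j D :
  (forall s, repeats s -> D s = 0) -> forall s, repeats s -> op_lift j D s = 0.
Proof.
move=> D0 s rs; rewrite /op_lift; case: odd.
  rewrite /diff_lift big1 ?oppr0 // => a _; apply: D0; exact: repeats_map.
by rewrite /sum_lift D0 // if_same.
Qed.

Variable c : M.

(** The augmentation, seen as a cochain of degree -1. *)
Definition at_nil s : M := if s is [::] then c else 0.

(** The comparison of the bar resolution of the cyclic group with its minimal
    resolution, in cochain form.  Each cochain is a lift of the coboundary of the
    previous one, starting from the augmentation. *)
Fixpoint cyclic_cochain (j : nat) : seq 'F_p -> M :=
  op_lift j (coboundary (if j is i.+1 then cyclic_cochain i else at_nil)).

Lemma cyclic_cochain_repeats j s : repeats s -> cyclic_cochain j s = 0.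
Proof.
elim: j s => [|j IH] s; apply: op_lift_repeats => {}s; apply: coboundary_repeats => //.
by case.
Qed.

(** The lifts exist since the coboundary of [cyclic_cochain j] is killed by the orbit
    operator of degree [j]: this operator turns [cyclic_cochain j] itself into a
    coboundary. *)
Lemma cyclic_cochainP :
  (forall s, orbit_sum p succ_Fp (cyclic_cochain 0) s = coboundary at_nil s) /\
  (forall j s, coboundary (cyclic_cochain j) s = op j.+1 (cyclic_cochain j.+1) s).
Proof.
have lift j D s : D [::] = 0 -> (forall s, op j.+1 D s = 0) -> op j (op_lift j D) s = D s.
  rewrite /orbit_op /op_lift /=; case: odd => /=.
    exact: orbit_diff_lift.
  exact: orbit_sum_lift.
have main j : forall s, op j (cyclic_cochain j) s =
    coboundary (if j is i.+1 then cyclic_cochain i else at_nil) s.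
  elim: j => [|j IH] s; rewrite /= lift // => {}s.
    rewrite /orbit_op /= /orbit_diff -coboundary_map -coboundaryB.
    rewrite -[RHS](coboundary0 M s); apply: eq_in_coboundary => -[|x u] _ /=; exact: subrr.
  rewrite -coboundary_orbit_op.
  rewrite -[RHS](coboundaryK (if j is i.+1 then cyclic_cochain i else at_nil) s).
  by apply: eq_in_coboundary => u _; rewrite -IH /orbit_op /= negbK.
by split=> [s|j s]; [exact: (main 0%N s) | rewrite main].
Qed.

End CyclicCochains.

(** * Barycentric subdivision in a simplex *)

Section Barycentre.
Variables (R : realFieldType) (V : finType).
Local Notation point := {ffun V -> R}.
Implicit Types (s t u : seq point).

Definition barycentre s : point := [ffun v => (\sum_(x <- s) x v) / (size s)%:R].

Definition barycentre_closed (C : point -> Prop) : Prop :=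
  forall s, s != [::] -> {in s, forall x, C x} -> C (barycentre s).

(** The diameter of the vertex set is at most [r] in the supremum distance, which is
    also the diameter of the simplex that it spans. *)
Definition small (r : R) s : Prop :=
  {in s &, forall x y : point, forall v, `|x v - y v| <= r}.

Lemma flag_in_closed (C : point -> Prop) s t :
  barycentre_closed C -> flag barycentre s t ->
  {in s, forall x, C x} -> {in t, forall x, C x}.
Proof.
move=> Cb; elim=> // {}s u {}t us _ IH Cs y; rewrite inE => /predU1P[->|].
  by apply: Cb => //; case: (s) us.
by apply: IH => x /(faces_subset us) /Cs.
Qed.

Lemma dist_barycentre (c : R) s v : s != [::] ->
  `|c - barycentre s v| <= (\sum_(x <- s) `|c - x v|) / (size s)%:R.
Proof.
move=> s0; have k0 : 0 < (size s)%:R :> R by rewrite ltr0n lt0n size_eq0.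
rewrite ler_pdivlMr // -{1}(gtr0_norm k0) -normrM ffunE mulrBl divfK ?gt_eqF //.
have -> : c * (size s)%:R = \sum_(x <- s) c.
  by rewrite big_const_seq count_predT iter_addr_0 mulr_natr.
by rewrite -sumrB; exact: ler_norm_sum.
Qed.

Lemma sum_le_size (I : eqType) (u : seq I) (f : I -> R) (r : R) :
  {in u, forall x, f x <= r} -> \sum_(x <- u) f x <= (size u)%:R * r.
Proof.
move=> fr; rewrite mulrC mulr_natr -iter_addr_0 -(count_predT u) -big_const_seq.
by rewrite big_seq [leRHS]big_seq; apply: ler_sum.
Qed.

Lemma ball_closed (c : point) (r : R) :
  barycentre_closed (fun x => forall v, `|c v - x v| <= r).
Proof.
move=> s s0 sC v; apply: le_trans (dist_barycentre (c v) v s0) _.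
have k0 : 0 < (size s)%:R :> R by rewrite ltr0n lt0n size_eq0.
rewrite ler_pdivrMr // mulrC; apply: sum_le_size => x xs; exact: sC.
Qed.

(** The average defining the distance from [y] to the barycentre has one zero term,
    the one of [y] itself; hence the factor [m / (m + 1)]. *)
Lemma barycentre_small m r s y v : y \in s -> (size s <= m.+1)%N -> 0 <= r ->
  small r s -> `|barycentre s v - y v| <= r * (m%:R / m.+1%:R).
Proof.
move=> ys sm r0 rs; rewrite distrC.
have s0 : s != [::] by case: (s) ys.
apply: le_trans (dist_barycentre (y v) v s0) _.
have k0 : 0 < (size s)%:R :> R by rewrite ltr0n lt0n size_eq0.
rewrite ler_pdivrMr // (perm_big _ (perm_to_rem ys)) big_cons /= subrr normr0 add0r.
apply: (@le_trans _ _ ((size (rem y s))%:R * r)).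
  by apply: sum_le_size => x /mem_rem xs; exact: rs.
rewrite size_rem // mulrC -mulrA ler_wpM2l // mulrAC ler_pdivlMr ?ltr0n //.
rewrite -!natrM ler_nat; case: (size s) sm => // k; rewrite ltnS /= => km.
by rewrite !mulnS [(m * k)%N]mulnC leq_add2r.
Qed.

Lemma smallS r s u : {subset u <= s} -> small r s -> small r u.
Proof. by move=> us rs x y /us xs /us ys; exact: rs. Qed.

(** The classical estimate for barycentric subdivision.  The old vertices lie in a
    ball around the barycentre of [s], balls are convex, and every vertex of the
    subdivided boundary is a convex combination of old vertices. *)
Lemma flag_small m r s t : flag barycentre s t -> (size s <= m.+1)%N -> 0 <= r ->
  small r s -> small (r * (m%:R / m.+1%:R)) t.
Proof.
move=> + + r0; elim=> [|{}s u {}t us ut IH] sm rs; first by move=> x y.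
have um : (size u <= m.+1)%N by rewrite (size_faces us) (leq_trans (leq_pred _)).
have {IH} tsmall := IH um (smallS (faces_subset us) rs).
have q0 : 0 <= r * (m%:R / m.+1%:R) by rewrite mulr_ge0 // divr_ge0.
have bt y v : y \in t -> `|barycentre s v - y v| <= r * (m%:R / m.+1%:R).
  move=> yt; apply: (flag_in_closed (@ball_closed (barycentre s) _) ut _ yt).
  by move=> x /(faces_subset us) xs w; exact: barycentre_small.
move=> x y; rewrite !inE => /predU1P[->|xt] /predU1P[->|yt] v.
- by rewrite subrr normr0.
- exact: bt.
- by rewrite distrC; exact: bt.
- exact: tsmall.
Qed.

Fixpoint iter_flag N s t : Prop :=
  if N is N'.+1 then exists2 u, flag barycentre s u & iter_flag N' u t
  else s = t.

Lemma size_iter_flag N s t : iter_flag N s t -> size t = size s.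
Proof.
elim: N s => [|N IH] s /=; first by move->.
by case=> u /size_flag <- /IH.
Qed.

Lemma iter_flag_small m r N s t : iter_flag N s t -> (size s <= m.+1)%N -> 0 <= r ->
  small r s -> small (r * (m%:R / m.+1%:R) ^+ N) t.
Proof.
elim: N r s => [|N IH] r s /=; first by move=> -> _ _; rewrite mulr1.
case=> u su ut sm r0 rs; rewrite exprS mulrA; apply: IH ut _ _ _.
- by rewrite (size_flag su).
- by rewrite mulr_ge0 // divr_ge0.
- exact: flag_small su _ _ _.
Qed.

Variable M : zmodType.

Definition iter_subdiv N : (seq point -> M) -> seq point -> M :=
  iter N (subdiv barycentre).

Lemma eq_in_iter_subdiv N (phi psi : seq point -> M) s :
  (forall t, iter_flag N s t -> phi t = psi t) ->
  iter_subdiv N phi s = iter_subdiv N psi s.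
Proof.
elim: N s => [|N IH] s E /=; first exact: E.
by apply: eq_in_subdiv => u su; apply: IH => t ut; apply: E; exists u.
Qed.

Lemma iter_subdivB N (phi psi : seq point -> M) s :
  iter_subdiv N (fun t => phi t - psi t) s = iter_subdiv N phi s - iter_subdiv N psi s.
Proof.
elim: N s => [|N IH] s //=; rewrite -subdivB; exact: eq_in_subdiv.
Qed.

Lemma iter_subdiv_sum N n (phi : 'I_n -> seq point -> M) s :
  iter_subdiv N (fun t => \sum_i phi i t) s = \sum_i iter_subdiv N (phi i) s.
Proof.
elim: N s => [|N IH] s //=; rewrite -subdiv_sum; exact: eq_in_subdiv.
Qed.

Lemma iter_subdiv_coboundary N (phi : seq point -> M) s :
  iter_subdiv N (coboundary phi) s = coboundary (iter_subdiv N phi) s.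
Proof.
elim: N s => [|N IH] s //=; rewrite -subdiv_coboundary; exact: eq_in_subdiv.
Qed.

Lemma iter_subdiv_nil N (phi : seq point -> M) : iter_subdiv N phi [::] = phi [::].
Proof. by elim: N => //= N IH; rewrite /subdiv. Qed.

Definition permute_coords (f : V -> V) (x : point) : point := [ffun v => x (f v)].

Lemma barycentre_permute f s :
  barycentre (map (permute_coords f) s) = permute_coords f (barycentre s).
Proof.
apply/ffunP => v; rewrite !ffunE size_map big_map.
by congr (_ / _); apply: eq_bigr => x _; rewrite ffunE.
Qed.

Lemma iter_subdiv_permute N f (phi : seq point -> M) s :
  iter_subdiv N phi (map (permute_coords f) s) =
  iter_subdiv N (phi \o map (permute_coords f)) s.
Proof.
elim: N s => [|N IH] s //=.
rewrite (subdiv_map (h := permute_coords f)).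
  by apply: eq_in_subdiv => t _ /=; exact: IH.
by move=> u _ _; exact: barycentre_permute.
Qed.

End Barycentre.

(** * A Tucker lemma for cyclic groups of prime order *)

Section Apex.
Variables (P : eqType) (p k : nat) (lab : P -> nat -> option 'F_p).
Implicit Types (s t : seq P).

Definition common_label s (i : nat) : bool :=
  if s is x :: _ then (lab x i != None) && all (fun y => lab y i == lab x i) s
  else false.

(** The least [i] for which all points of [s] carry the same [i]-th label.  It can
    only decrease when [s] shrinks, since a smaller set has more common labels. *)
Definition apex_index s : nat := find (common_label s) (iota 0 k.+1).

Definition apex s : 'F_p :=
  if s is x :: _ then odflt 0 (lab x (apex_index s)) else 0.

Definition labelled s : Prop := exists2 i, (i <= k)%N & common_label s i.

Lemma common_labelP s i : reflect
  (s <> [::] /\ exists b, {in s, forall x, lab x i = Some b}) (common_label s i).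
Proof.
apply: (iffP idP).
  case: s => // x s /andP[]; case E: (lab x i) => [b|] // _ /allP sE.
  by split=> //; exists b => y /sE /eqP.
case: s => [[]//|x s [_ [b bE]]] /=.
rewrite bE ?mem_head //= eqxx /=; apply/allP => y ys.
by rewrite bE // inE ys orbT.
Qed.

Lemma common_labelS s t i :
  {subset t <= s} -> t != [::] -> common_label s i -> common_label t i.
Proof.
move=> ts /eqP t0 /common_labelP[_ [b bE]]; apply/common_labelP; split=> //.
by exists b => x /ts /bE.
Qed.

Lemma labelledS s t : {subset t <= s} -> t != [::] -> labelled s -> labelled t.
Proof. by move=> ts t0 [i ik /(common_labelS ts t0)]; exists i. Qed.

Lemma apex_indexP s : labelled s ->
  [/\ (apex_index s <= k)%N & {in s, forall x, lab x (apex_index s) = Some (apex s)}].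
Proof.
move=> [i ik si]; have has_s : has (common_label s) (iota 0 k.+1).
  by apply/hasP; exists i; rewrite // mem_iota.
have lt : (apex_index s < k.+1)%N.
  by rewrite /apex_index -[X in (_ < X)%N](size_iota 0 k.+1) -has_find.
split=> //; have := nth_find 0%N has_s; rewrite nth_iota // add0n -/(apex_index s).
case/common_labelP; rewrite /apex; case: s {si has_s lt} => // x s _ [b bE] y ys.
by rewrite !bE // mem_head.
Qed.

Lemma apex_indexS s t : {subset t <= s} -> t != [::] -> (apex_index t <= apex_index s)%N.
Proof. by move=> ts t0; apply: sub_find => i; exact: common_labelS. Qed.

(** Going down a flag of faces the least common index decreases weakly, and if it
    stays the same then so does the label, both being read off any common point.
    Hence without repetitions the indices decrease strictly. *)
Lemma flag_apex_repeats s (t : seq 'F_p) : labelled s -> flag apex s t -> ~~ repeats t ->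
  (size t <= (apex_index s).+1)%N.
Proof.
move=> + st; elim: st => // {}s u {}t us ut IH sl /=.
rewrite negb_or => /andP[hd nr].
have [u0|u0] := eqVneq u [::].
  by rewrite (size_flag ut) u0.
have ul : labelled u := labelledS (faces_subset us) u0 sl.
rewrite ltnS; apply: leq_trans (IH ul nr) _.
rewrite ltn_neqAle (apex_indexS (faces_subset us)) // andbT.
apply: contra hd => /eqP e; case: ut us u0 ul e {IH nr} => //= {}u w {}t wu _ us u0 ul e.
have [x xu] : exists x, x \in u by case: (u) u0 => // x ?; exists x; rewrite mem_head.
have [_ /(_ x xu)] := apex_indexP ul; rewrite e.
by have [_ /(_ x (faces_subset us xu)) ->] := apex_indexP sl => -[->].
Qed.

Variable g : P -> P.
Hypothesis p_pr : prime p.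

Lemma apex_map s : s != [::] -> labelled s ->
  (forall x i, x \in s -> lab (g x) i = omap (@succ_Fp p) (lab x i)) ->
  apex (map g s) = succ_Fp (apex s).
Proof.
move=> s0 sl sE.
have cE : common_label (map g s) =1 common_label s.
  move=> i; apply/common_labelP/common_labelP => -[_ [b bE]]; split.
  - exact/eqP.
  - exists (b - 1) => x xs; have := bE _ (map_f g xs); rewrite sE //.
    by case: (lab x i) => //= a [<-]; rewrite addrK.
  - by case: (s) s0.
  - by exists (succ_Fp b) => _ /mapP[x xs ->]; rewrite sE // bE.
have iE : apex_index (map g s) = apex_index s by apply: eq_find.
have [_ aE] := apex_indexP sl.
rewrite /apex; case: s s0 iE aE sE {cE sl} => // x s _ /= -> aE sE.
by rewrite sE ?mem_head // aE ?mem_head.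
Qed.

End Apex.

(** [spanning t] stands for: the points of [t] lie in a common simplex.  The label
    [lab x i] is meant to be defined when the [i]-th join coordinate of the image
    of [x] is positive, and gives the position in its orbit of the corresponding
    group element. *)
Section TuckerLemma.
Variables (R : realType) (V : finType) (p k n : nat).
Local Notation point := {ffun V -> R}.
Variables (f : V -> V) (v : nat -> point) (lab : point -> nat -> option 'F_p).
Variable spanning : seq point -> Prop.

Local Notation h := (@permute_coords R V f).

Hypothesis p_pr : prime p.
Hypothesis h_order : forall x, iter p h x = x.
Hypothesis spanningS : forall s t, {subset t <= s} -> spanning s -> spanning t.
Hypothesis spanning_flag : forall s t, flag (@barycentre R V) s t -> spanning s -> spanning t.
Hypothesis spanning_join : forall j s, (j <= n)%N -> join_simplex h v j s -> spanning s.
Hypothesis spanning_bounded : forall s, spanning s -> small 1 s.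
Hypothesis lab_act : forall s x i, spanning s -> x \in s ->
  lab (h x) i = omap (@succ_Fp p) (lab x i).
Variable e : R.
Hypothesis e_gt0 : 0 < e.
Hypothesis lab_small : forall s, spanning s -> s != [::] -> small e s -> labelled k lab s.

Let q : R := n%:R / n.+1%:R.

Lemma expr_lt_small : exists N, q ^+ N <= e.
Proof.
have q0 : 0 <= q by rewrite divr_ge0.
have q1 : `|q| < 1 by rewrite ger0_norm // ltr_pdivrMr ?ltr0n // mul1r ltr_nat.
have /cvgrPdist_le/(_ _ e_gt0)[N _ /(_ N (leqnn N))] := cvg_expr q1.
by rewrite /= sub0r normrN ger0_norm ?exprn_ge0 //; exists N.
Qed.

Lemma size_join_simplex j s : join_simplex h v j s -> size s = j.+1.
Proof. by elim=> //= {}j {}s _; rewrite ?size_map // => ->. Qed.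

(** If [k < n], every simplex of the subdivision of [e_n] has [n + 1 > k + 1] vertices
    and so a repeated label, so that the pulled back cochain of degree [n]
    vanishes on [e_n]; this contradicts [join_chain_orbit_sum]. *)
Theorem labelling_dim : (n <= k)%N.
Proof.
have [N qN] := expr_lt_small.
rewrite leqNgt; apply/negP => kn.
have charF (x : 'F_p) : x *+ p = 0 by rewrite -mulr_natr pchar_Fp_0 ?mulr0.
pose tiny s := spanning s /\ (size s <= n.+1)%N.
have fine s t : tiny s -> iter_flag N s t -> spanning t /\ small e t.
  move=> [gs sn] st; split.
    by elim: (N) s gs st {sn} => [|N' IH] s gs /=; [move<-|case=> u /spanning_flag/(_ gs) /IH].
  have := iter_flag_small st sn ler01 (spanning_bounded gs); rewrite mul1r => tq x y xt yt w.
  exact: le_trans (tq x y xt yt w) qN.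
(* Pull-back of cochains from the labels to the original complex: [N] barycentric
   subdivisions make the simplices small, and a last subdivision reads the labels. *)
pose Psi (phi : seq 'F_p -> 'F_p) := iter_subdiv N (subdiv (apex k lab) phi).
(* The labels of faces are equivariant for small simplices only, so the
   equivariance of the pull-back has to be established simplex by simplex. *)
have Psi_act phi s : tiny s -> Psi phi (map h s) = Psi (phi \o map (@succ_Fp p)) s.
  move=> ts; rewrite /Psi iter_subdiv_permute; apply: eq_in_iter_subdiv => t st /=.
  have [gt te] := fine _ _ ts st.
  apply: subdiv_map => u ut u0; apply: apex_map => //.
    by apply: lab_small => //; [exact: spanningS gt|exact: smallS te].
  by move=> x i xu; apply: lab_act gt _; exact: ut.
have Psi_iter phi a j s : (j <= n)%N -> join_simplex h v j s ->
    Psi phi (map (iter a h) s) = Psi (phi \o map (iter a (@succ_Fp p))) s.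
  move=> jn js; elim: a phi => [|a IH] phi.
    rewrite (map_id s); apply: eq_in_iter_subdiv => t _; apply: eq_in_subdiv => w _ /=.
    by rewrite (map_id w).
  rewrite (eq_map (g := h \o iter a h)) // map_comp Psi_act; last first.
    have := join_simplex_iter a js => as'; split; first exact: spanning_join as'.
    by rewrite (size_join_simplex as').
  rewrite IH; apply: eq_in_iter_subdiv => t _; apply: eq_in_subdiv => w _ /=.
  by rewrite -map_comp.
have Psi_op phi i j s : (j <= n)%N -> join_simplex h v j s ->
    orbit_op p h i (Psi phi) s = Psi (orbit_op p (@succ_Fp p) i phi) s.
  move=> jn js; rewrite /orbit_op; case: odd.
    have E := Psi_iter phi 1%N _ _ jn js.
    rewrite /orbit_diff /Psi -/(Psi phi) (E : Psi phi (map h s) = _) -iter_subdivB.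
    by apply: eq_in_iter_subdiv => t _; rewrite -subdivB.
  transitivity (\sum_(a < p) Psi (phi \o map (iter a (@succ_Fp p))) s).
    by apply: eq_bigr => a _; exact: Psi_iter js.
  rewrite -iter_subdiv_sum; apply: eq_in_iter_subdiv => t _.
  by rewrite -subdiv_sum.
have Psi_cob phi s : coboundary (Psi phi) s = Psi (coboundary phi) s.
  rewrite -iter_subdiv_coboundary; apply: eq_in_iter_subdiv => t _.
  by rewrite subdiv_coboundary.
have eq_Psi phi psi s : phi =1 psi -> Psi phi s = Psi psi s.
  by move=> E; apply: eq_in_iter_subdiv => t _; apply: eq_in_subdiv => w _; exact: E.
pose Phi j := Psi (@cyclic_cochain 'F_p p 1 j).
have [cc0 ccS] := cyclic_cochainP p_pr (1 : 'F_p).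
have Phi0 : orbit_sum p h (Phi 0%N) [:: v 0%N] = 1.
  have := Psi_op (@cyclic_cochain 'F_p p 1 0) 0%N 0%N [:: v 0%N] (leq0n _) (join_simplex0 _ _).
  rewrite /orbit_op /= => ->; rewrite (eq_Psi _ _ _ cc0) -Psi_cob /=.
  by rewrite subr0 /Psi iter_subdiv_nil.
have PhiS j s : (j < n)%N -> join_simplex h v j.+1 s ->
    coboundary (Phi j) s = orbit_op p h j.+1 (Phi j.+1) s.
  move=> jn js; rewrite Psi_cob (Psi_op _ _ _ _ _ js) //.
  by apply: eq_Psi => w; exact: ccS.
have := join_chain_orbit_sum h_order charF Phi0 PhiS (leqnn n).
apply/eqP; rewrite eq_sym; suff -> : join_chain p h v n (orbit_sum p h (Phi n)) = 0.
  exact: oner_neq0.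
rewrite -[RHS](join_chain0 'F_p p h v n); apply: eq_in_join_chain => s js.
rewrite /orbit_sum big1 // => a _; have {}js := join_simplex_iter a js.
set s' := map _ s in js *.
have -> : Phi n s' = Psi (fun=> 0) s'.
  apply: eq_in_iter_subdiv => t st; apply: eq_in_subdiv => w tw.
  apply: cyclic_cochain_repeats; apply/negPn/negP => nr.
  have ts' : tiny s'.
    by rewrite /tiny (size_join_simplex js); split=> //; exact: spanning_join js.
  have [gt te] := fine _ _ ts' st.
  have wn : size w = n.+1.
    by rewrite (size_flag tw) (size_iter_flag st) (size_join_simplex js).
  have t0 : t != [::] by rewrite -size_eq0 -(size_flag tw) wn.
  have tl := lab_small gt t0 te.
  have := flag_apex_repeats tl tw nr; rewrite wn ltnS.
  have [ik _] := apex_indexP tl => /leq_trans/(_ ik).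
  by rewrite leqNgt kn.
rewrite -[RHS](subrr (Psi (fun=> 0) s')) /Psi -iter_subdivB.
apply: eq_in_iter_subdiv => t _; rewrite -subdivB.
by apply: eq_in_subdiv => w _; rewrite subrr.
Qed.

End TuckerLemma.

(** * Groups that are not nice *)

Section DisjointCycles.
Local Open Scope group_scope.

(** For elements of different prime orders there is nothing to prove.  In a p-group
    that is not nice the subgroup generated by the elements of order [p] has more
    than [p] elements, so some [y] of order [p] lies outside the group generated by a given
    central [z] of order [p]; as [z] is central, so do all conjugates of [y]. *)
Lemma not_nice_disjoint_cycles (gT : finGroupType) :
  (1 < #|gT|)%N -> ~ nice gT ->
  exists x y : gT, [/\ prime #[x], prime #[y] &
    forall g, <[x]> :&: <[y]> :^ g = 1].
Proof.
move=> gT1 nn; pose G := [set: gT]%G.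
have oG : #|G| = #|gT| by rewrite cardsT.
have TI x y g : #[x] != #[y] -> prime #[x] -> prime #[y] -> <[x]> :&: <[y]> :^ g = 1.
  move=> xy px py; apply: coprime_TIg.
  by rewrite cardJg prime_coprime // dvdn_prime2.
pose p := pdiv #|G|.
have p_pr : prime p by rewrite pdiv_prime // oG.
have [x Gx ox] := Cauchy p_pr (pdiv_dvd #|G|).
have [pG|npG] := boolP (p.-group G); last first.
  have : ~~ (p.-nat #|G|) by [].
  rewrite /pnat cardG_gt0 /= => /allPn[q]; rewrite mem_primes => /and3P[q_pr _ qG].
  rewrite !inE => qp.
  have [y Gy oy] := Cauchy q_pr qG.
  exists x, y; rewrite ox oy; split=> // g; apply: TI; rewrite ?ox ?oy //.
  by rewrite eq_sym.
have ntG : G :!=: 1 by rewrite -cardG_gt1 oG.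
have Zp : (p %| #|'Z(G)|)%N.
  have := center_nil_eq1 (pgroup_nil pG); rewrite (negPf ntG) => ntZ.
  have [] // := pgroup_pdiv (pgroupS (center_sub G) pG) (negbT ntZ).
have [z Zz oz] := Cauchy p_pr Zp.
have [Ohm_p|Ohm_np] := eqVneq #|'Ohm_1(G)| p.
  case: nn; case/(prime_Ohm1P pG ntG)/orP : Ohm_p => [cG|/andP[_]].
    left; split=> //; have [k] := p_natP pG.
    by rewrite oG => ->; exists p, k.
  by move=> /eqP/quaternion_classP[k k2 iso]; right; exists k.
have [y [oy yz]] : exists y, #[y] = p /\ y \notin <[z]>.
  apply/not_existsP => all; case/eqP: Ohm_np.
  rewrite -[RHS]oz; congr #|pred_of_set _|.
  apply/eqP; rewrite finset.eqEsubset (OhmE 1 pG) expn1; apply/andP; split.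
    rewrite gen_subG; apply/fintype.subsetP => y /setIP[_]; rewrite inE => /eqP yp.
    have : (#[y] %| p)%N by rewrite order_dvdn yp.
    have [/eqP|y1] := eqVneq #[y] 1%N.
      by rewrite order_eq1 => /eqP -> _; exact: group1.
    case/primeP: p_pr => _ /[apply]; rewrite (negPf y1) /=.
    move=> /eqP oy; apply/negPn/negP => yz; by apply: (all y).
  rewrite cycle_subG; apply: mem_gen; rewrite !inE /= -oz; exact/eqP/expg_order.
exists z, y; split; rewrite ?oz ?oy // => g.
apply: prime_TIg; rewrite -?orderE ?oz //.
rewrite cycle_subG mem_conjg; apply/negP.
have -> : z ^ g^-1 = z.
  apply/conjg_fixP/commgP.
  have /centerP[_ H] := Zz; apply: H; exact: finset.in_setT.
move=> zy; case/negP: yz.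
have /eqP -> : <[z]> :==: <[y]>; last exact: cycle_id.
by rewrite eqEcard cycle_subG zy -!orderE oz oy leqnn.
Qed.

End DisjointCycles.

(** * Lebesgue numbers for geometric realizations *)

Definition in_simplex (R : realType) (V : finType) (s : {set V}) (x : V -> R) : Prop :=
  std_simplex x /\ forall v, v \notin s -> x v = 0.

Section Lebesgue.
Variables (R : realType) (gT : finGroupType) (K : gComplex gT).
Local Notation V := (vertex K).
Local Notation coords := (@set_val {ptws V -> R} (@realization_set R gT K)).

Lemma realization_setP (x : {ptws V -> R}) :
  @realization_set R gT K x <-> exists2 s, s \in simplices K & in_simplex s x.
Proof.
split=> [[xD xK]|[s sK [xD xs]]].
  by exists [set v | x v != 0]%SET => //; split=> // v; rewrite inE negbK => /eqP.
split=> //; apply: simplices_sub sK _ _.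
  apply/fintype.subsetP => v; rewrite inE; apply: contraR => vs; apply/eqP; exact: xs.
have [_ x1] := xD; apply/negP => /eqP supp0.
have /eqP : \sum_v x v = 0; last by rewrite x1 oner_eq0.
apply: big1 => v _; apply/eqP.
by have := finset.in_set0 v; rewrite -supp0 inE => /negbFE.
Qed.

Lemma coord_ptws_continuous (v : V) : continuous (fun x : {ptws V -> R} => x v).
Proof. exact: (@proj_continuous V (fun=> R) v). Qed.

Lemma sum_ptws_continuous (P : pred V) :
  continuous (fun x : {ptws V -> R} => \sum_(v | P v) x v).
Proof.
apply: (@continuous_big R V +%R 0 P) => [|v _]; last exact: coord_ptws_continuous.
exact: add_continuous.
Qed.

(** Supports can shrink but not grow in the limit, and a complex is closed under
    passing to faces.  Formally, the realization is a finite union of closed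
    simplices. *)
Lemma realization_set_closed : closed (@realization_set R gT K).
Proof.
have -> : @realization_set R gT K =
    (\bigcap_(v in [set: V]) [set x | 0 <= x v]) `&` [set x | \sum_v x v = 1] `&`
    \bigcup_(s in [set s | s \in simplices K])
      \bigcap_(v in [set v | v \notin s]) [set x | x v = 0].
  apply/seteqP; split=> x /=.
    move=> /realization_setP[s sK [[x0 x1] xs]].
    by split; [split=> // v _; exact: x0 | exists s].
  move=> [[x0 x1] [s sK xs]]; apply/realization_setP; exists s => //.
  by split=> //; split=> // v; exact: x0.
apply: closedI; first apply: closedI.
- apply: closed_bigI => v _.
  apply: (@preimage_closed _ _ (fun x : {ptws V -> R} => x v) [set y | 0 <= y]).
    by move=> x _; exact: coord_ptws_continuous.
  exact: closed_ge.
- apply: (@preimage_closed _ _ (fun x : {ptws V -> R} => \sum_v x v) [set y | y = 1]).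
    by move=> x _; exact: sum_ptws_continuous.
  exact: closed_eq.
- apply: closed_bigcup => [|s _]; first exact: finite_finset.
  apply: closed_bigI => v _.
  apply: (@preimage_closed _ _ (fun x : {ptws V -> R} => x v) [set y | y = 0]).
    by move=> x _; exact: coord_ptws_continuous.
  exact: closed_eq.
Qed.

Lemma realization_coord_le1 x v : @realization_set R gT K x -> 0 <= x v <= 1.
Proof.
move=> [[x0 <-] _]; rewrite x0 /= (bigD1 v) //= lerDl; apply: sumr_ge0 => w _; exact: x0.
Qed.

(** The realization carries the topology of pointwise convergence, whereas balls and
    compactness criteria are at hand for row vectors; so the covering argument is
    carried out on the space of row vectors indexed by the vertices. *)
Lemma lebesgue_number (I : Type) (U : I -> set (realization R K)) :
  (forall i, open (U i)) -> (forall x, exists i, U i x) ->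
  exists2 e : R, 0 < e & forall x, exists i, forall y,
    (forall v, `|coords x v - coords y v| <= e) -> U i y.
Proof.
move=> oU covU.
pose pt (r : 'rV[R]_#|V|) : {ptws V -> R} := fun v => r ord0 (enum_rank v).
have ptc : continuous pt.
  by apply: ptws_continuous => v; exact: coord_continuous.
pose X := pt @^-1` @realization_set R gT K.
have cX : compact X.
  apply: (@subclosed_compact _ _ [set r : 'rV[R]_#|V| | forall j, `[0, 1]%classic (r ord0 j)]).
  - by move/continuous_closedP : ptc; apply; exact: realization_set_closed.
  - apply: (@rV_compact R _ (fun=> `[0, 1]%classic)) => j; exact: segment_compact.
  - move=> r Xr j /=; rewrite in_itv /=.
    by have := realization_coord_le1 (enum_val j) Xr; rewrite /pt enum_valK.
pose P (e : R) (r : 'rV[R]_#|V|) := exists i, forall y : realization R K,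
  (forall v, `|pt r v - coords y v| <= e) -> U i y.
have := (compact_near_coveringP X).1 cX R (0^'+)%R P _.
case=> [r Xr|d /= d0 Hd].
  pose x : realization R K := exist _ (pt r) (mem_set Xr).
  have [i Ux] := covU x.
  have [W oW WU] : exists2 W : set {ptws V -> R}, open W & coords @^-1` W = U i.
    by have [W oW WU] := oU i; exists W.
  have /nbhs_ballP[d d0 dW] : nbhs r (pt @^-1` W).
    apply: ptc; apply: open_nbhs_nbhs; split => //.
    by move: Ux; rewrite -WU.
  exists (ball r (d / 2), [set e | e < d / 2]).
    split; first by apply: nbhsx_ballx; rewrite divr_gt0.
    by apply: nbhs_right_lt; rewrite divr_gt0.
  move=> [r' e] /= [rr' ed]; exists i => y ry.
  rewrite -WU /=; pose s : 'rV[R]_#|V| := \row_j coords y (enum_val j).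
  have -> : coords y = pt s by apply/funext => v; rewrite /pt mxE enum_rankK.
  apply: dW; split => // a j; rewrite (ord1 a) /ball /= mxE.
  case: rr' => _ /(_ ord0 j); rewrite /ball /= => rr'.
  have := ry (enum_val j); rewrite /pt enum_valK => r'y.
  rewrite -(subrKA (r' ord0 j)); apply: le_lt_trans (ler_normD _ _) _.
  by rewrite (splitr d) ltrD // (le_lt_trans r'y).
exists (d / 2); first by rewrite divr_gt0.
move=> x.
have Xx : X (\row_j coords x (enum_val j)).
  rewrite /X /= (_ : pt _ = coords x); first exact: set_mem (valP x).
  by apply/funext => v; rewrite /pt mxE enum_rankK.
have [||i Hi] := Hd (d / 2) _ _ _ Xx.
- by rewrite /= sub0r normrN gtr0_norm ?divr_gt0 // ltr_pdivrMr // ltr_pMr // ltr1n.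
- by rewrite divr_gt0.
exists i => y xy; apply: Hi => v; by rewrite /pt mxE enum_rankK.
Qed.

End Lebesgue.

(** * The complexes induced from a subgroup *)

Section Label.
Variables (R : realType) (gT : finGroupType) (k : nat).
Local Notation E := (EG R gT k).
Local Notation preE := (prejoin R k (group_gSpace gT)).

(** The [i]-th point of a join element, provided that its barycentric coordinate does
    not vanish; otherwise this point is not determined by the element. *)
Definition label (z : E) (i : 'I_k.+1) : option gT :=
  let q := join_repr z in if \val q.1 i != 0 then Some (q.2 i : gT) else None.

Lemma label_pi (q : preE) i :
  label (join_pi q : E) i = if \val q.1 i != 0 then Some (q.2 i : gT) else None.
Proof.
have /join_piP[e1 e2] := join_reprK (join_pi q).
by rewrite /label -e1; case: ifPn => // /e2 ->.
Qed.

Lemma label_act g (z : E) i : label (gact g z) i = omap (fun a => (g * a)%g) (label z i).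
Proof.
rewrite -(join_reprK z) /= (join_gactE (X := group_gSpace gT)) !label_pi /=.
by case: ifP.
Qed.

Lemma label_open i g : open [set z : E | label z i = Some g].
Proof.
suff : open (@join_pi R k (group_gSpace gT) @^-1` [set z : E | label z i = Some g]) by [].
have -> : @join_pi R k (group_gSpace gT) @^-1` [set z : E | label z i = Some g] =
    [set q : preE | \val q.1 i != 0] `&` [set q : preE | q.2 i = g].
  apply/seteqP; split=> q /=; rewrite label_pi; case: ifP => // _.
  - by case=> <-.
  - by case=> _ ->.
  - by case.
have ptc (T : topologicalType) j : continuous (fun y : {ptws 'I_k.+1 -> T} => y j).
  exact: (@proj_continuous 'I_k.+1 (fun=> T) j).
apply: openI.
  apply: (@open_comp _ _ (fun q : preE => \val q.1 i) [set y : R | y != 0]);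
    last exact: open_neq.
  move=> q _; apply: (@continuous_comp preE _ _ fst (fun t => \val t i)); first exact: cvg_fst.
  apply: (@continuous_comp _ {ptws 'I_k.+1 -> R} _ set_val (fun y => y i)); last exact: ptc.
  exact: initial_continuous.
apply: (@open_comp _ _ (fun q : preE => q.2 i) [set g : discrete_topology gT]);
  last exact: discrete_open.
move=> q _.
apply: (@continuous_comp preE {ptws 'I_k.+1 -> discrete_topology gT} _
  snd (fun y => y i)).
  exact: cvg_snd.
exact: ptc.
Qed.

Lemma label_cover (z : E) : exists i g, label z i = Some g.
Proof.
have [t0 t1] := set_mem (valP (join_repr z).1).
have [i ti] : exists i, \val (join_repr z).1 i != 0.
  apply/not_existsP => all0; move: t1; rewrite big1 => [/esym/eqP|i _].
    by rewrite oner_eq0.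
  by apply/eqP/negPn/negP; exact: all0.
by exists i, ((join_repr z).2 i); rewrite /label ti.
Qed.

End Label.

Section CosetJoin.
Variables (gT : finGroupType) (n : nat) (H : {group gT}).
Local Notation V := ('I_n.+1 * gT)%type.
Implicit Types (v w : V) (s t : {set V}).

(** The edges of [E_n G] that stay in one left coset of [H]. *)
Definition joinable v w : bool :=
  (v.2^-1 * w.2 \in H)%g && ((v.1 == w.1) ==> (v == w)).

Definition coset_join_simplices : {set {set V}} :=
  [set s | (s != finset.set0) && [forall v in s, forall w in s, joinable v w]]%SET.

Lemma coset_join_simplicesP s : reflect
  (s != finset.set0 /\ {in s &, forall v w, joinable v w}) (s \in coset_join_simplices).
Proof.
rewrite inE; apply: (iffP andP) => -[s0 sP]; split=> //.
  by move=> v w vs ws; move/forall_inP: sP => /(_ v vs)/forall_inP/(_ w ws).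
apply/forall_inP => v vs; apply/forall_inP => w ws; exact: sP.
Qed.

Definition coset_join_act (g : gT) v : V := (v.1, (g * v.2)%g).

Lemma coset_join_simplices_neq0 s : s \in coset_join_simplices -> s != finset.set0.
Proof. by case/coset_join_simplicesP. Qed.

Lemma coset_join_simplices_vertex v : [set v]%SET \in coset_join_simplices.
Proof.
apply/coset_join_simplicesP; split; first by apply/finset.set0Pn; exists v; rewrite inE.
move=> w w' /finset.set1P -> /finset.set1P ->.
by rewrite /joinable mulVg group1 !eqxx.
Qed.

Lemma coset_join_simplices_sub s t : s \in coset_join_simplices ->
  t \subset s -> t != finset.set0 -> t \in coset_join_simplices.
Proof.
move=> /coset_join_simplicesP[_ sP] /fintype.subsetP ts t0.
by apply/coset_join_simplicesP; split=> // v w /ts vs /ts ws; exact: sP.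
Qed.

Lemma coset_join_act1 v : coset_join_act 1 v = v.
Proof. by case: v => i a; rewrite /coset_join_act mul1g. Qed.

Lemma coset_join_actM g h v :
  coset_join_act (g * h) v = coset_join_act g (coset_join_act h v).
Proof. by rewrite /coset_join_act /= mulgA. Qed.

Lemma coset_join_act_simplicial g s : s \in coset_join_simplices ->
  (coset_join_act g @: s)%SET \in coset_join_simplices.
Proof.
move=> /coset_join_simplicesP[/finset.set0Pn[v vs] sP].
apply/coset_join_simplicesP; split.
  by apply/finset.set0Pn; exists (coset_join_act g v); apply: finset.imset_f.
move=> _ _ /imsetP[w ws ->] /imsetP[w' ws' ->].
have /andP[wH wE] := sP _ _ ws ws'.
rewrite /joinable /= invMg -mulgA mulKg wH /=.
by apply/implyP => e; move: wE; rewrite e => /eqP ->.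
Qed.

(** The induced complex [G x_H E_n H], as the disjoint union over the left cosets
    [gH] of the [n+1]-fold joins of [gH] inside [E_n G]. *)
Definition coset_join : gComplex gT :=
  GComplex coset_join_simplices_neq0 coset_join_simplices_vertex
    coset_join_simplices_sub coset_join_act1 coset_join_actM
    coset_join_act_simplicial.

End CosetJoin.

Section CosetJoinSpace.
Variables (R : realType) (gT : finGroupType) (n : nat) (H : {group gT}).
Local Notation V := ('I_n.+1 * gT)%type.
Local Notation X := (realization_gSpace R (coset_join n H)).
Local Notation coords := (@set_val {ptws V -> R} (@realization_set R gT (coset_join n H))).

Lemma coset_join_supp (x : X) (v w : V) :
  coords x v != 0 -> coords x w != 0 -> joinable H v w.
Proof.
have [_ /coset_join_simplicesP[_ xP]] := set_mem (valP x).
by move=> xv xw; apply: xP; rewrite inE.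
Qed.

Lemma coset_join_supp_neq0 (x : X) : exists v : V, coords x v != 0.
Proof.
have [_ /coset_join_simplicesP[/finset.set0Pn[v] + _]] := set_mem (valP x).
by rewrite inE; exists v.
Qed.

Lemma coset_join_coords_act g (x : X) (v : V) :
  coords (gact g x) (coset_join_act g v) = coords x v.
Proof.
transitivity (coords x (coset_join_act g^-1 (coset_join_act g v))) => //.
by rewrite -coset_join_actM mulVg coset_join_act1.
Qed.

Lemma coset_join_free : free_gComplex R (coset_join n H).
Proof.
move=> g x gx; have [v xv] := coset_join_supp_neq0 x.
have : coords x (coset_join_act g v) != 0 by rewrite -{1}gx coset_join_coords_act.
move=> /(coset_join_supp xv)/andP[_ /=]; rewrite eqxx /= -pair_eqE /= eqxx /=.
rewrite eq_sym => /eqP gv; by rewrite -[g](mulgK v.2) gv mulgV.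
Qed.

End CosetJoinSpace.

(** * Equivariant maps out of the induced complexes *)

Section UpperBound.
Variables (R : realType) (gT : finGroupType) (n : nat) (H : {group gT}).
Local Notation V := ('I_n.+1 * gT)%type.
Local Notation X := (realization_gSpace R (coset_join n H)).
Local Notation coords := (@set_val {ptws V -> R} (@realization_set R gT (coset_join n H))).
Implicit Types (x y : X).

Lemma coords_continuous (v : V) : continuous (fun x : X => coords x v).
Proof.
move=> x; apply: (@continuous_comp (realization R (coset_join n H)) {ptws V -> R} R
  coords (fun z => z v)).
  exact: initial_continuous.
exact: (@proj_continuous V (fun=> R) v).
Qed.

(** Supports can only grow nearby. *)
Lemma near_supp x : \forall y \near x, forall v : V, coords x v != 0 -> coords y v != 0.
Proof.
apply: (@filter_forall X V
  (fun v y => coords x v != 0 -> coords y v != 0) (nbhs x) _) => v.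
have [xv|xv] := eqVneq (coords x v) 0.
  by apply: nearW => y /=; rewrite ?xv ?eqxx.
have : nbhs (coords x v) [set r : R | r != 0].
  by apply: open_nbhs_nbhs; split=> //; exact: open_neq.
by move=> /(@coords_continuous v x); apply: (@filterS X (nbhs x)) => y.
Qed.

Lemma join_weight_subproof x :
  std_simplex (fun i : 'I_n.+1 => \sum_(g : gT) coords x (i, g)).
Proof.
have [[x0 x1] _] := set_mem (valP x); split=> [i|].
  by apply: sumr_ge0 => g _; exact: x0.
by rewrite -x1 pair_big; apply: eq_bigr => -[].
Qed.

Definition join_weight x : set_type (@std_simplex R 'I_n.+1) :=
  exist (fun t => t \in @std_simplex R 'I_n.+1) _ (mem_set (join_weight_subproof x)).

Lemma join_weight_continuous : continuous join_weight.
Proof.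
apply: set_type_continuous; apply: ptws_continuous => i /=.
apply: (@continuous_big R gT +%R 0 xpredT) => [|g _]; last exact: coords_continuous.
exact: add_continuous.
Qed.

Definition join_point x (i : 'I_n.+1) : discrete_topology gT :=
  odflt 1%g [pick g | coords x (i, g) != 0].

(** The map to the join when the points [c i] are prescribed.  Unlike [join_point],
    which jumps where a weight vanishes, a constant choice is visibly
    continuous. *)
Definition join_with (c : 'I_n.+1 -> discrete_topology gT) x : EG R gT n :=
  join_pi (join_weight x, c).

Definition to_join x : EG R gT n := join_with (join_point x) x.

Definition selects (c : 'I_n.+1 -> gT) x : Prop :=
  forall v : V, coords x v != 0 -> v.2 = c v.1.

Lemma join_point_selects x : selects (join_point x) x.
Proof.
move=> [i g] /= xig; rewrite /join_point; case: pickP => [g' xig'|/(_ g)]; last by rewrite xig.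
by have /andP[_ /=] := coset_join_supp xig xig'; rewrite eqxx -pair_eqE /= eqxx => /eqP.
Qed.

Lemma to_joinE c x : selects c x -> to_join x = join_with c x.
Proof.
move=> cx; apply/join_piP; split=> //= i wi.
have [g xig] : exists g, coords x (i, g) != 0.
  apply/not_existsP => all0; case/eqP: wi; apply: big1 => g _.
  by apply/eqP/negPn/negP; exact: all0.
by rewrite -(join_point_selects xig) (cx _ xig).
Qed.

Lemma join_with_continuous c : continuous (join_with c).
Proof.
move=> x; apply: (@continuous_comp _ (prejoin R n (group_gSpace gT)) _
  (fun y => (join_weight y, c)) (@join_pi R n (group_gSpace gT))).
  apply: (@cvg_pair _ _ _ (nbhs x) (nbhs (join_weight x))
    (nbhs (c : {ptws 'I_n.+1 -> discrete_topology gT}))) => /=.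
    exact: join_weight_continuous.
  exact: cvg_cst.
exact: pi_continuous.
Qed.

(** On the closed simplex selected by [c] the map agrees with the continuous map
    [join_with c]; there are finitely many such closed simplices, and a point that
    is sufficiently close to [x] lies only in simplices that contain [x]. *)
Lemma to_join_continuous : continuous to_join.
Proof.
move=> x W Wx.
have Wc : \forall y \near x, forall c : {ffun 'I_n.+1 -> gT}, selects c x -> W (join_with c y).
  apply: (@filter_forall X {ffun 'I_n.+1 -> gT}
    (fun c y => selects c x -> W (join_with c y)) (nbhs x) _) => c.
  have [cx|ncx] := pselect (selects c x); last exact: nearW.
  have : nbhs x (join_with c @^-1` W) by apply: join_with_continuous; rewrite -to_joinE.
  by apply: (@filterS X (nbhs x)) => y ? _.
apply: (@filterS2 X (nbhs x)) Wc (near_supp x) => y Wc xy /=.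
pose c := [ffun i => join_point y i : gT].
have cy : selects c y by move=> v /join_point_selects ->; rewrite ffunE.
rewrite (to_joinE cy); apply: Wc => v /xy; exact: cy.
Qed.

Lemma to_join_equivariant : equivariant to_join.
Proof.
move=> g x; have cx := @join_point_selects x.
rewrite (@to_joinE (fun i => (g * join_point x i)%g)) => [|v].
  rewrite /to_join /join_with /= (join_gactE (X := group_gSpace gT)); congr join_pi.
  congr pair; apply/val_inj/funext => i /=.
  rewrite (reindex_inj (mulgI g)); apply: eq_bigr => a _.
  exact: (coset_join_coords_act g x (i, a)).
case: v => i a; have := coset_join_coords_act g x (i, (g^-1 * a)%g).
rewrite /coset_join_act /= mulKVg => -> xv.
by rewrite -(cx _ xv) /= mulKVg.
Qed.

(** The projection from [G x_H E_n H] to [G/H]. *)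
Definition coset_of_point x : {set gT} :=
  if [pick v : V | coords x v != 0] is Some v then (v.2 *: H)%g else finset.set0.

Lemma coset_of_pointE x (v : V) : coords x v != 0 -> coset_of_point x = (v.2 *: H)%g.
Proof.
rewrite /coset_of_point => xv; case: pickP => [w xw|/(_ v)]; last by rewrite xv.
apply: lcoset_eqP; have /andP[vw _] := coset_join_supp xv xw.
by rewrite mem_lcoset.
Qed.

Lemma coset_of_point_near x : \forall y \near x, coset_of_point y = coset_of_point x.
Proof.
have [v xv] := coset_join_supp_neq0 x.
apply: (@filterS X (nbhs x)) (near_supp x) => y /(_ v xv) yv.
by rewrite (coset_of_pointE xv) (coset_of_pointE yv).
Qed.

Lemma coset_of_point_act g x : coset_of_point (gact g x) = (g *: coset_of_point x)%g.
Proof.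
have [v xv] := coset_join_supp_neq0 x.
rewrite (coset_of_pointE xv) -lcosetM; apply: (@coset_of_pointE _ (coset_join_act g v)).
by rewrite coset_join_coords_act.
Qed.

End UpperBound.

(** A free [G]-set is a disjoint union of copies of [G]: a point corresponds to the
    group element that carries the chosen representative of its orbit to it. *)
Lemma free_equivariant_section (gT : finGroupType) (T : choiceType)
    (act : gT -> T -> T) (D : T -> Prop) :
  (forall x, act 1%g x = x) ->
  (forall g h x, act (g * h)%g x = act g (act h x)) ->
  (forall g x, D x -> act g x = x -> g = 1%g) ->
  exists phi : T -> gT, forall g x, D x -> phi (act g x) = (g * phi x)%g.
Proof.
move=> act1 actM free.
pose rep x := choose (fun y => [exists g, y == act g x]) x.
have orb x : [exists g, x == act g x] by apply/fintype.existsP; exists 1%g; rewrite act1.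
have repP x : exists g, x = act g (rep x).
  have /fintype.existsP[g /eqP E] : [exists g, rep x == act g x].
    exact: (@chooseP _ (fun y => [exists g, y == act g x]) x (orb x)).
  by exists g^-1%g; rewrite E -actM mulVg act1.
have rep_act g x : rep (act g x) = rep x.
  have E : (fun y => [exists h, y == act h (act g x)]) =1 (fun y => [exists h, y == act h x]).
    move=> y; apply/idP/idP => /fintype.existsP[h /eqP->]; apply/fintype.existsP.
      by exists (h * g)%g; rewrite actM.
    by exists (h * g^-1)%g; rewrite -actM mulgKV.
  rewrite /rep (eq_choose E); apply: choose_id; last exact: orb.
  by apply/fintype.existsP; exists g.
pose phi x := odflt 1%g [pick g | x == act g (rep x)].
have phiP x : x = act (phi x) (rep x).
  rewrite /phi; case: pickP => [g /eqP//|no].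
  by have [g /eqP E] := repP x; move: (no g); rewrite E.
exists phi => g x Dx.
have repE : rep x = act (phi x)^-1%g x by rewrite -[LHS]act1 -(mulVg (phi x)) actM -phiP.
have gE : act (phi (act g x)) (rep x) = act g x by rewrite -(rep_act g x) -phiP.
have /(free _ _ Dx) : act (g^-1 * phi (act g x) * (phi x)^-1)%g x = x.
  by rewrite !actM -repE gE -actM mulVg act1.
by move=> /eqP; rewrite -eq_mulgV1 => /eqP <-; rewrite mulKVg.
Qed.

(** * The index of the induced complexes *)

Section Product.
Variables (R : realType) (gT : finGroupType) (n m : nat) (H K : {group gT}).
Hypothesis HK : forall g, (H :&: K :^ g)%g = 1%g.
Local Notation X := (realization_gSpace R (coset_join n H)).
Local Notation Y := (realization_gSpace R (coset_join m K)).

Lemma one_simplex : std_simplex (fun _ : 'I_1 => 1 : R).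
Proof. by split=> //; rewrite big_ord1. Qed.

Definition group_to_join (g : gT) : EG R gT 0 :=
  join_pi (exist (fun t => t \in @std_simplex R 'I_1) _ (mem_set one_simplex),
    fun=> g : discrete_topology gT).

(** The stabilizer of [(aH, bK)] in [G/H x G/K] is the intersection of a conjugate of
    [H] with a conjugate of [K], hence trivial, so that there is an equivariant map
    from [G/H x G/K] to [G].  Composed with the locally constant projections it
    is continuous. *)
Lemma product_map : exists f : prod_gSpace X Y -> EG R gT 0, continuous f /\ equivariant f.
Proof.
pose act (g : gT) (A : {set gT} * {set gT}) := ((g *: A.1)%g, (g *: A.2)%g).
pose D (A : {set gT} * {set gT}) := exists a b, A = ((a *: H)%g, (b *: K)%g).
have [] := @free_equivariant_section gT _ act D.
- by case=> A B; rewrite /act /= !lcoset1.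
- by move=> g h [A B]; rewrite /act /= -!lcosetM.
- move=> g _ [a [b ->]] [] /=; rewrite -!lcosetM => /lcoset_eqP + /lcoset_eqP.
  rewrite !mem_lcoset => gaH gbK.
  have aH : (g ^ a \in H)%g by rewrite conjgE.
  have bK : (g ^ b \in K)%g by rewrite conjgE.
  have : (g ^ a \in H :&: K :^ (b^-1 * a))%g.
    by rewrite inE aH mem_conjg invMg invgK -conjgM mulKVg.
  by rewrite HK => /set1gP/eqP; rewrite conjg_eq1 => /eqP.
move=> phi phiE.
pose F (z : prod_gSpace X Y) := phi (coset_of_point z.1, coset_of_point z.2).
exists (group_to_join \o F); split.
  move=> z; apply: cvg_near_cst.
  have n1 := coset_of_point_near z.1; have n2 := coset_of_point_near z.2.
  have : nbhs z [set w : X * Y | coset_of_point w.1 = coset_of_point z.1 /\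
      coset_of_point w.2 = coset_of_point z.2].
    by exists ([set w | coset_of_point w = coset_of_point z.1],
      [set w | coset_of_point w = coset_of_point z.2]).
  by apply: (@filterS (prod_gSpace X Y) (nbhs z)) => w [E1 E2]; rewrite /= /F E1 E2.
move=> g [x y]; rewrite /= (join_gactE (X := group_gSpace gT)).
congr join_pi; congr pair; apply/funext => i /=.
rewrite /F /= !coset_of_point_act; apply: (phiE g (_, _)).
have [v xv] := coset_join_supp_neq0 x; have [w yw] := coset_join_supp_neq0 y.
by exists v.2, w.2; rewrite (coset_of_pointE xv) (coset_of_pointE yw).
Qed.

End Product.

(** The discrete logarithm to base [x] of the position of [g] in its right coset of
    the group generated by [x]. *)
Lemma equivariant_log (gT : finGroupType) (x : gT) : prime #[x]%g ->
  exists beta : gT -> 'F_#[x]%g, forall g, beta (x * g)%g = succ_Fp (beta g).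
Proof.
move=> x_pr.
have /choice[e eE] : forall g, exists e, (x ^+ e = g * (repr (<[x]> :* g))^-1)%g.
  move=> g; have /cycleP[e ->] : (g * (repr (<[x]> :* g))^-1 \in <[x]>)%g; last by exists e.
  rewrite -groupV invMg invgK; have := mem_repr_rcoset <[x]> g.
  by rewrite mem_rcoset.
exists (fun g => (e g)%:R) => g.
have : (x ^+ e (x * g) == x ^+ (e g).+1)%g.
  by rewrite expgS !eE mulgA rcosetM rcoset_id ?cycle_id.
rewrite eq_expg_mod_order => /eqP E.
by rewrite /succ_Fp natr1; apply: val_inj; rewrite /= !val_Fp_nat.
Qed.

Section LowerBound.
Variables (R : realType) (gT : finGroupType) (n k : nat) (a : gT).
Hypothesis a_pr : prime #[a]%g.
Local Notation V := ('I_n.+1 * gT)%type.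
Local Notation K := (coset_join n <[a]>%G).
Local Notation X := (realization_gSpace R K).
Local Notation point := {ffun V -> R}.

Definition vertex_point (v : V) : point := [ffun w => (w == v)%:R].

Definition spans (t : seq point) : Prop :=
  exists2 s, s \in simplices K & {in t, forall x : point, in_simplex s x}.

Lemma in_simplex_closed (s : {set V}) :
  barycentre_closed (fun x : point => in_simplex s x).
Proof.
move=> t t0 ts; have k0 : (size t)%:R != 0 :> R by rewrite pnatr_eq0 size_eq0.
split; first split=> [v|].
- rewrite ffunE divr_ge0 // big_seq; apply: sumr_ge0 => x /ts[[x0 _] _]; exact: x0.
- under eq_bigr => v _ do rewrite ffunE.
  rewrite -mulr_suml exchange_big /= big_seq (eq_bigr (fun=> 1)) => [|x /ts[[]]//].
  by rewrite -big_seq big_const_seq count_predT iter_addr_0 divff.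
- by move=> v vs; rewrite ffunE big_seq big1 ?mul0r // => x /ts[_]; exact.
Qed.

Definition act_point : point -> point := permute_coords (coset_join_act a^-1%g).

Lemma act_vertex_point v : act_point (vertex_point v) = vertex_point (coset_join_act a v).
Proof.
apply/ffunP => w; rewrite !ffunE; congr (nat_of_bool _)%:R.
by apply/eqP/eqP => [<-|->]; rewrite -coset_join_actM ?mulgV ?mulVg coset_join_act1.
Qed.

Lemma act_point_order x : iter #[a]%g act_point x = x.
Proof.
have E j : iter j act_point x = permute_coords (coset_join_act (a ^- j)%g) x.
  elim: j => [|j IH].
    by apply/ffunP => v; rewrite ffunE expg0 invg1 coset_join_act1.
  apply/ffunP => v; rewrite /= IH !ffunE -coset_join_actM; congr (x (coset_join_act _ v)).
  by rewrite expgS invMg.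
apply/ffunP => v; rewrite E ffunE expg_order invg1 coset_join_act1 //.
Qed.

Definition base_vertex (j : nat) : point := vertex_point (inord j, 1%g).

(** The [j]-simplices of [E_n H] occurring in the chain [e_j] are spanned by vertices
    [(i, c i)] with [i <= j], one for each [i]. *)
Lemma join_simplex_spans j t : (j <= n)%N -> join_simplex act_point base_vertex j t -> spans t.
Proof.
move=> jn js.
have [c cH ct] : exists2 c : nat -> gT, (forall i, c i \in <[a]>%g) &
    {in t, forall x, exists2 i, (i <= j)%N & x = vertex_point (inord i, c i)}.
  elim: js {jn} => [|{}j {}t _ [c cH ct]|{}j {}t _ [c cH ct]].
  - by exists (fun=> 1%g) => [i|x]; rewrite ?group1 // inE => /eqP ->; exists 0%N.
  - exists (fun i => (a * c i)%g) => [i|_ /mapP[x /ct[i ij ->] ->]].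
      by rewrite groupM ?cycle_id.
    by exists i => //; rewrite act_vertex_point.
  - exists (fun i => if i == j.+1 then 1%g else c i) => [i|x].
      by case: eqP => // _; exact: group1.
    rewrite inE => /predU1P[->|/ct[i ij ->]].
      by exists j.+1; rewrite ?eqxx.
    by exists i; [exact: leqW | rewrite ltn_eqF // ltnS].
exists [set (i, c i) | i : 'I_n.+1]%SET.
  apply/coset_join_simplicesP; split.
    by apply/finset.set0Pn; exists ((ord0 : 'I_n.+1), c 0%N); apply/imsetP; exists ord0.
  move=> _ _ /imsetP[i _ ->] /imsetP[i' _ ->]; rewrite /joinable /=.
  by rewrite groupM ?groupV //=; apply/implyP => /eqP ->.
move=> x /ct[i ij ->]; split; first split=> [v|].
- by rewrite ffunE.
- rewrite (bigD1 (inord i, c i)) //= ffunE eqxx big1 ?addr0 // => v /negPf vi.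
  by rewrite ffunE vi.
- move=> v vs; rewrite ffunE; case: eqP => // vE; case/negP: vs; apply/imsetP.
  exists (inord i) => //; rewrite vE inordK //.
  by rewrite ltnS (leq_trans ij).
Qed.

(** Dold's theorem for a subgroup of prime order.  The labels of a point are read off
    from its image in [E_k G]; by the choice of a Lebesgue number small simplices
    have a common label. *)
Lemma lower_bound (f : X -> EG R gT k) : continuous f -> equivariant f -> (n <= k)%N.
Proof.
move=> fc fe; have [beta betaE] := equivariant_log a_pr.
have realized s (x : point) : s \in simplices K -> in_simplex s x -> @realization_set R gT K x.
  by move=> sK xs; apply/realization_setP; exists s.
pose pt (x : point) (hx : @realization_set R gT K x) : X :=
  exist (fun t => t \in @realization_set R gT K) (x : {ptws V -> R}) (mem_set hx).
pose lab (x : point) (i : nat) : option 'F_#[a]%g :=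
  if pselect (@realization_set R gT K x) is left hx
  then omap beta (label (f (pt x hx)) (inord i)) else None.
have labE x hx i : lab x i = omap beta (label (f (pt x hx)) (inord i)).
  by rewrite /lab; case: pselect => // hx'; rewrite (Prop_irrelevance hx hx').
have [e e0 He] : exists2 e : R, 0 < e & forall x : X, exists i : 'I_k.+1 * gT, forall y : X,
    (forall v, `|set_val x v - set_val y v| <= e) -> label (f y) i.1 = Some i.2.
  apply: (@lebesgue_number R gT K _ (fun i => f @^-1` [set z | label z i.1 = Some i.2])).
    by move=> i; apply: open_comp; [move=> ? _; exact: fc | exact: label_open].
  by move=> x; have [i [g E]] := label_cover (f x); exists (i, g).
apply: (@labelling_dim R V #[a]%g k n _ base_vertex lab spans a_pr
  act_point_order _ _ _ _ _ e e0).
- by move=> s t ts [u uK us]; exists u => // x /ts; exact: us.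
- move=> s t st [u uK us]; exists u => //.
  exact: flag_in_closed (@in_simplex_closed u) st us.
- exact: join_simplex_spans.
- move=> s [u uK us] x y /us xu /us yu v.
  have /andP[x0 x1] := @realization_coord_le1 R gT K _ v (realized _ _ uK xu).
  have /andP[y0 y1] := @realization_coord_le1 R gT K _ v (realized _ _ uK yu).
  by rewrite ler_norml; apply/andP; split; lra.
- move=> s x i [u uK us] /us xu; have hx := realized _ _ uK xu.
  have hax : @realization_set R gT K (act_point x).
    have := coord_gact_realization a hx; congr realization_set.
    by apply/funext => v; rewrite ffunE.
  rewrite (labE _ hx) (labE _ hax) (_ : pt _ hax = gact a (pt _ hx)).
    by rewrite fe label_act; case: label => //= g; rewrite betaE.
  by apply/val_inj/funext => v; rewrite /= ffunE.
- move=> s [u uK us] s0 se; case: s s0 us se => // x s _ us se.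
  have hx := realized _ _ uK (us x (mem_head _ _)).
  have [[i g] /= iE] := He (pt x hx); exists i; first by rewrite -ltnS.
  apply/common_labelP; split=> //; exists (beta g) => y ys.
  have hy := realized _ _ uK (us y ys).
  by rewrite (labE _ hy) inord_val iE // => v; apply: se => //; exact: mem_head.
Qed.

End LowerBound.

Lemma ind_coset_join (R : realType) (gT : finGroupType) (n : nat) (a : gT) :
  prime #[a]%g -> ind R (realization_gSpace R (coset_join n <[a]>%G)) = Some n.
Proof.
move=> a_pr; apply/min_natP; split=> [|k [f [fc fe]]]; last exact: lower_bound fc fe.
exists (@to_join R gT n <[a]>%G); split; first exact: to_join_continuous.
exact: to_join_equivariant.
Qed.

Theorem theorem1 (R : realType) (gT : finGroupType)
    (gT_nontrivial : (1 < #|gT|)%N) (gT_not_nice : ~ nice gT)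
    (n : nat) (n_ge1 : (1 <= n)%N) :
  poljak_rodl R gT n = Some 0%N.
Proof.
have [a [b [a_pr b_pr ab]]] := not_nice_disjoint_cycles gT_nontrivial gT_not_nice.
apply/min_natP; split=> //.
exists (coset_join n <[a]>%G), (coset_join n <[b]>%G); split.
- exact: coset_join_free.
- exact: coset_join_free.
- exact: ind_coset_join.
- exact: ind_coset_join.
- by apply/min_natP; split=> //; exact: product_map.
Qed.
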